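(* Let $G$ and $H$ be two countable groups, at least one of which has Kazhdan's property (T). (1) If $G$ and $H$ are both Hilbert-Schmidt stable, then $G\times H$ is Hilbert-Schmidt stable. (2) If $G$ and $H$ are both Hilbert-Schmidt flexibly stable, then $G\times H$ is Hilbert-Schmidt flexibly stable.
   Context: For $k\geq 1$, $\mathcal{U}(k)$ is the unitary group of $M_k(\mathbf{C})$, and $\|x\|_2=(\frac1k\mathrm{Tr}(x^*x))^{1/2}$ is the normalized Hilbert-Schmidt norm. A countable group $\Gamma$ is Hilbert-Schmidt stable if for every sequence of maps $\varphi_n:\Gamma\to\mathcal{U}(k_n)$ with $\lim_n\|\varphi_n(gh)-\varphi_n(g)\varphi_n(h)\|_2=0$ for all $g,h\in\Gamma$, there exist group homomorphisms $\pi_n:\Gamma\to\mathcal{U}(k_n)$ with $\lim_n\|\varphi_n(g)-\pi_n(g)\|_2=0$ for all $g\in\Gamma$. It is Hilbert-Schmidt flexibly stable if for every such sequence there exist integers $m_n\geq k_n$ with $m_n/k_n\to 1$ and homomorphisms $\pi_n:\Gamma\to\mathcal{U}(m_n)$ such that $\lim_n\|\varphi_n(g)-P_n\pi_n(g)P_n\|_2=0$ for all $g\in\Gamma$, where $P_n\pi_n(g)P_n$ denotes the upper-left $k_n\times k_n$ corner of $\pi_n(g)$ and $\|\cdot\|_2$ is normalized by $k_n$. *)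

(* Defs.v *)
From HB Require Import structures.
From mathcomp Require Import all_boot all_order all_algebra.
From mathcomp Require Import all_classical all_reals all_analysis.
From mathcomp Require Import complex.

Set Implicit Arguments.
Unset Strict Implicit.
Unset Printing Implicit Defensive.

Import Order.TTheory GRing.Theory Num.Theory.
Import numFieldNormedType.Exports.
Local Open Scope classical_set_scope.
Local Open Scope ring_scope.

Section ProdGroup.
Variables G H : groupType.

Definition prod_group : Type := (G * H)%type.
HB.instance Definition _ := Choice.on prod_group.

Definition pg_one : prod_group := (monoid.one, monoid.one).
Definition pg_inv (x : prod_group) : prod_group := (monoid.inv x.1, monoid.inv x.2).
Definition pg_mul (x y : prod_group) : prod_group :=
  (monoid.mul x.1 y.1, monoid.mul x.2 y.2).

Lemma pg_mulA : associative pg_mul.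
Proof. by move=> [a b] [c d] [e f]; rewrite /pg_mul /= !monoid.mulgA. Qed.
Lemma pg_mul1 : left_id pg_one pg_mul.
Proof. by move=> [a b]; rewrite /pg_mul /= !monoid.mul1g. Qed.
Lemma pg_mulg1 : right_id pg_one pg_mul.
Proof. by move=> [a b]; rewrite /pg_mul /= !monoid.mulg1. Qed.
Lemma pg_mulV : left_inverse pg_one pg_inv pg_mul.
Proof. by move=> [a b]; rewrite /pg_mul /= !monoid.mulVg. Qed.
Lemma pg_mulgV : right_inverse pg_one pg_inv pg_mul.
Proof. by move=> [a b]; rewrite /pg_mul /= !monoid.mulgV. Qed.

HB.instance Definition _ :=
  monoid.isGroup.Build prod_group pg_mulA pg_mul1 pg_mulg1 pg_mulV pg_mulgV.
End ProdGroup.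

Definition countable_group (G : groupType) : Prop :=
  exists f : G -> nat, injective f.

Section Defs.
Variable R : realType.
Local Notation C := R[i].

Definition adjmx {k : nat} (x : 'M[C]_k) : 'M[C]_k := (map_mx (@conjc R) x)^T.

Definition unitarymx {k : nat} (u : 'M[C]_k) : Prop := adjmx u *m u = 1%:M.

(* ||x||_2 = ((1/k) Tr(x^* x))^(1/2); Tr(x^* x) is real, we take its real part *)
Definition hsnorm {k : nat} (x : 'M[C]_k) : R :=
  Num.sqrt ((k%:R)^-1 * complex.Re (\tr (adjmx x *m x))).

Definition corner {k m : nat} (le : (k <= m)%N) (x : 'M[C]_m) : 'M[C]_k :=
  \matrix_(i < k, j < k) x (widen_ord le i) (widen_ord le j).

Definition HS_stable (Gm : groupType) : Prop :=
  forall (k : nat -> nat) (phi : forall n, Gm -> 'M[C]_(k n)),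
    (forall n, (0 < k n)%N) ->
    (forall n g, unitarymx (phi n g)) ->
    (forall g h : Gm,
        hsnorm (phi n (monoid.mul g h) - phi n g *m phi n h) @[n --> \oo] --> 0) ->
    exists pi : forall n, Gm -> 'M[C]_(k n),
      (forall n g, unitarymx (pi n g)) /\
      (forall n (g h : Gm), pi n (monoid.mul g h) = pi n g *m pi n h) /\
      (forall g, hsnorm (phi n g - pi n g) @[n --> \oo] --> 0).

Definition HS_flex_stable (Gm : groupType) : Prop :=
  forall (k : nat -> nat) (phi : forall n, Gm -> 'M[C]_(k n)),
    (forall n, (0 < k n)%N) ->
    (forall n g, unitarymx (phi n g)) ->
    (forall g h : Gm,
        hsnorm (phi n (monoid.mul g h) - phi n g *m phi n h) @[n --> \oo] --> 0) ->
    exists (m : nat -> nat) (le : forall n, (k n <= m n)%N)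
           (pi : forall n, Gm -> 'M[C]_(m n)),
      (forall n g, unitarymx (pi n g)) /\
      (forall n (g h : Gm), pi n (monoid.mul g h) = pi n g *m pi n h) /\
      ((m n)%:R / (k n)%:R @[n --> \oo] --> (1 : R)) /\
      (forall g, hsnorm (phi n g - corner (le n) (pi n g)) @[n --> \oo] --> 0).

(* Kazhdan's property (T), tested on unitary representations on l^2(N)      *)
(* (the separable infinite-dimensional Hilbert space)         *)
Definition cnorm2 (z : C) : R := complex.Re z ^+ 2 + complex.Im z ^+ 2.

Definition l2 (x : nat -> C) : Prop :=
  cvgn (series (fun i => cnorm2 (x i))).

Definition l2norm (x : nat -> C) : R :=
  Num.sqrt (limn (series (fun i => cnorm2 (x i)))).

Definition unitary_rep (Gm : groupType) (pi : Gm -> (nat -> C) -> (nat -> C)) : Prop :=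
  [/\ (forall g x, l2 x -> l2 (pi g x)),
      (forall g (a : C) x y, l2 x -> l2 y ->
          pi g (fun i => a * x i + y i) = (fun i => a * pi g x i + pi g y i)),
      (forall g x, l2 x -> l2norm (pi g x) = l2norm x),
      (forall x, l2 x -> pi monoid.one x = x) &
      (forall g h x, l2 x -> pi (monoid.mul g h) x = pi g (pi h x))].

Definition propertyT (Gm : groupType) : Prop :=
  forall pi : Gm -> (nat -> C) -> (nat -> C),
    unitary_rep pi ->
    (forall (Q : seq Gm) (eps : R), 0 < eps ->
        exists xi, [/\ l2 xi, l2norm xi = 1 &
          forall g, g \in Q -> l2norm (fun i => pi g xi i - xi i) < eps]) ->
    exists xi, [/\ l2 xi, xi <> (fun _ => 0) & forall g, pi g xi = xi].

End Defs.

(* Main.v *)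
(** Let [G] have property (T).  Stability of [G] turns an asymptotic homomorphism
    [phi] of [G x H] into one whose restriction to [G] is close to a genuine
    representation [pi].  The matrices [phi (1, h)] almost commute with [pi]; by (T),
    applied to the conjugation representation of [G] on matrices, they are close to the
    commutant of [pi], and polar decomposition makes them unitaries of that commutant.
    So [H] is mapped almost multiplicatively into the unitary group of
    [pi(G)' = sum_i M_(d_i) (x) 1_(e_i)].  Stability of [H], put in the form of an
    inequality between squared norms that is additive over direct sums, corrects all the
    blocks at once (the few bad blocks being paid for by the linear term), and the
    corrected representation of [H] commutes with [pi].  Kazhdan's property yields a
    uniform spectral gap on finite-dimensional representations: otherwise the direct sum
    of a sequence of counterexamples would almost have invariant vectors, but none. *)
Require Import Defs.
From HB Require Import structures.
From mathcomp Require Import all_boot all_order all_algebra.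
From mathcomp Require Import all_classical all_reals all_analysis.
From mathcomp Require Import complex mxtens ring lra.

Set Implicit Arguments.
Unset Strict Implicit.
Unset Printing Implicit Defensive.

Import Order.TTheory GRing.Theory Num.Theory.
Import numFieldNormedType.Exports.
Local Open Scope classical_set_scope.
Local Open Scope ring_scope.

(** * Adjoints and the Frobenius norm *)

(** Stability of [H] speaks of one sequence of matrix algebras, whereas the blocks of [pi(G)'] have
    unrelated sizes and multiplicities, and the defect may concentrate on a few of them. The
    hypothesis on [H] is therefore first made uniform: in every dimension d, cost <= eps d + K
    defect, with K depending only on eps and a finite subset of [H]. Norms are squared and
    unnormalized, so that amplifying a block by 1_e multiplies both sides by e. Since K depends on
    eps, a diagonal choice is needed at the end to let eps tend to 0.

    In the flexible case [pi] lives on a larger space than [phi]. The matrices of [phi] are then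
    extended by the identity on the complement: this keeps them unitary and leaves unchanged the
    norms of their multiplicative defects and commutators, while the complement is small enough for
    the extension to remain close to [pi]. *)

Definition adj (R : realType) m n (A : 'M[R[i]]_(m, n)) : 'M[R[i]]_(n, m) :=
  (map_mx (@conjc R) A)^T.
Local Notation "A ^h" := (adj A) (at level 3, left associativity, format "A ^h").

Section Frobenius.
Variable R : realType.
Local Notation C := R[i].
Local Notation Re := (@complex.Re R).

Lemma adjE m n (A : 'M[C]_(m, n)) i j : A^h i j = conjc (A j i).
Proof. by rewrite !mxE. Qed.

Lemma adj_unitmx n (A : 'M[C]_n) : (A^h \in unitmx) = (A \in unitmx).
Proof. by rewrite /adj unitmx_tr map_unitmx. Qed.

Lemma trmxC_adj m n (A : 'M[C]_(m, n)) : map_mx Num.conj A^T = A^h.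
Proof. by apply/matrixP => i j; rewrite !mxE. Qed.

Lemma adjK m n (A : 'M[C]_(m, n)) : A^h^h = A.
Proof. by apply/matrixP => i j; rewrite !mxE conjcK. Qed.

Lemma adjM m n p (A : 'M[C]_(m, n)) (B : 'M[C]_(n, p)) : (A *m B)^h = B^h *m A^h.
Proof. by rewrite /adj map_mxM trmx_mul. Qed.

Lemma adjD m n (A B : 'M[C]_(m, n)) : (A + B)^h = A^h + B^h.
Proof. by rewrite /adj map_mxD linearD. Qed.

Lemma adjN m n (A : 'M[C]_(m, n)) : (- A)^h = - A^h.
Proof. by rewrite /adj map_mxN linearN. Qed.

Lemma adjB m n (A B : 'M[C]_(m, n)) : (A - B)^h = A^h - B^h.
Proof. by rewrite adjD adjN. Qed.

Lemma adjZ m n a (A : 'M[C]_(m, n)) : (a *: A)^h = conjc a *: A^h.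
Proof. by apply/matrixP => i j; rewrite !mxE rmorphM. Qed.

Lemma adj_scalar n (a : C) : (a%:M : 'M[C]_n)^h = (conjc a)%:M.
Proof. by rewrite /adj map_scalar_mx tr_scalar_mx. Qed.

Lemma adj1 n : (1%:M : 'M[C]_n)^h = 1%:M.
Proof. by rewrite adj_scalar conjc1. Qed.

Lemma adj0 m n : (0 : 'M[C]_(m, n))^h = 0.
Proof. by apply/matrixP => i j; rewrite !mxE conjc0. Qed.

Lemma adj_row_mx m n1 n2 (A : 'M[C]_(m, n1)) (B : 'M[C]_(m, n2)) :
  (row_mx A B)^h = col_mx A^h B^h.
Proof. by rewrite /adj map_row_mx tr_row_mx. Qed.

Lemma adj_block_mx m1 m2 n1 n2 (A : 'M[C]_(m1, n1)) (B : 'M[C]_(m1, n2))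
    (D : 'M[C]_(m2, n1)) (E : 'M[C]_(m2, n2)) :
  (block_mx A B D E)^h = block_mx A^h D^h B^h E^h.
Proof. by rewrite /adj map_block_mx tr_block_mx. Qed.

Lemma adj_tens m n p q (A : 'M[C]_(m, n)) (B : 'M[C]_(p, q)) :
  (A *t B)^h = A^h *t B^h.
Proof. by rewrite /adj map_mxT trmx_tens. Qed.

(** Rectangular isometries are needed as soon as dimensions may grow. On square matrices this is
    [unitarymx] up to conversion. *)
Definition isom m n (J : 'M[C]_(m, n)) : Prop := J^h *m J = 1%:M.

Lemma isom1 n : isom (1%:M : 'M[C]_n).
Proof. by rewrite /isom adj1 mul1mx. Qed.

Lemma isomM m n p (A : 'M[C]_(m, n)) (B : 'M[C]_(n, p)) :
  isom A -> isom B -> isom (A *m B).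
Proof. by move=> hA hB; rewrite /isom adjM mulmxA -(mulmxA B^h) hA mulmx1. Qed.

Lemma isomK m n p (A : 'M[C]_(m, n)) (B : 'M[C]_(p, m)) :
  isom B -> B^h *m (B *m A) = A.
Proof. by move=> h; rewrite mulmxA h mul1mx. Qed.

Lemma unitaryC n (u : 'M[C]_n) : isom u -> u *m u^h = 1%:M.
Proof. exact: mulmx1C. Qed.

Lemma isom_adj n (u : 'M[C]_n) : isom u -> isom u^h.
Proof. by move=> h; rewrite /isom adjK unitaryC. Qed.

Lemma tens11 d e : (1%:M : 'M[C]_d) *t (1%:M : 'M[C]_e) = 1%:M.
Proof.
apply/matrixP=> i j; case: (mxtens_indexP i) => i1 i2; case: (mxtens_indexP j) => j1 j2.
rewrite tensmxE !mxE (can_eq (@mxtens_indexK _ _)) xpair_eqE.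
by do 2 case: eqP => _; rewrite ?mulr0 ?mul0r ?mulr1.
Qed.

Lemma isom_tens m n p q (A : 'M[C]_(m, n)) (B : 'M[C]_(p, q)) :
  isom A -> isom B -> isom (A *t B).
Proof. by move=> hA hB; rewrite /isom adj_tens tensmx_mul hA hB tens11. Qed.

Lemma isom_block m1 n1 m2 n2 (A : 'M[C]_(m1, n1)) (B : 'M[C]_(m2, n2)) :
  isom A -> isom B -> isom (block_mx A 0 0 B).
Proof.
move=> hA hB; rewrite /isom adj_block_mx mulmx_block !adj0 !mul0mx !mulmx0.
by rewrite !addr0 !add0r hA hB -scalar_mx_block.
Qed.

Lemma isom_row_mx m n1 n2 (A : 'M[C]_(m, n1)) (B : 'M[C]_(m, n2)) :
  isom A -> isom B -> A^h *m B = 0 -> isom (row_mx A B).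
Proof.
move=> hA hB AB; rewrite /isom adj_row_mx mul_col_row hA hB AB.
by rewrite -[B^h *m A]adjK adjM adjK AB adj0 -scalar_mx_block.
Qed.

Lemma isom_leq m n (J : 'M[C]_(m, n)) : isom J -> (n <= m)%N.
Proof. exact: mulmx1_min. Qed.

Definition dot m n (A B : 'M[C]_(m, n)) : R := Re (\tr (A^h *m B)).
Definition fro2 m n (A : 'M[C]_(m, n)) : R := \sum_i \sum_j cnorm2 (A i j).

Lemma cnorm2_ge0 (z : C) : 0 <= cnorm2 z.
Proof. by rewrite addr_ge0 ?sqr_ge0. Qed.

Lemma cnorm2_eq0 (z : C) : cnorm2 z = 0 -> z = 0.
Proof.
move=> /eqP; rewrite paddr_eq0 ?sqr_ge0 // !sqrf_eq0 => /andP[/eqP h1 /eqP h2].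
by apply/eqP; rewrite eq_complex h1 h2 !eqxx.
Qed.

Lemma cnorm2E (z : C) : (cnorm2 z)%:C%C = conjc z * z.
Proof.
case: z => a b; apply/eqP; rewrite /cnorm2 eq_complex /=.
by apply/andP; split; apply/eqP; ring.
Qed.

Lemma fro2_ge0 m n (A : 'M[C]_(m, n)) : 0 <= fro2 A.
Proof. by do 2 apply: sumr_ge0 => ? _; exact: cnorm2_ge0. Qed.
#[local] Hint Resolve fro2_ge0 : core.

Lemma fro2_eq0 m n (A : 'M[C]_(m, n)) : fro2 A = 0 -> A = 0.
Proof.
move=> h; apply/matrixP => i j; rewrite mxE; apply: cnorm2_eq0; apply/eqP.
have /eqP := h; rewrite psumr_eq0; last by move=> ? _; apply: sumr_ge0 => ? _; exact: cnorm2_ge0.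
move/allP => /(_ i (mem_index_enum _)) /=; rewrite psumr_eq0; last by move=> ? _; exact: cnorm2_ge0.
by move/allP => /(_ j (mem_index_enum _)).
Qed.

Lemma fro20 m n : fro2 (0 : 'M[C]_(m, n)) = 0.
Proof. by apply: big1 => i _; apply: big1 => j _; rewrite mxE /cnorm2 /= expr0n addr0. Qed.

Lemma fro2C m n (A : 'M[C]_(m, n)) : \tr (A^h *m A) = (fro2 A)%:C%C.
Proof.
rewrite /fro2 exchange_big /mxtrace raddf_sum; apply: eq_bigr => j _.
rewrite raddf_sum mxE; apply: eq_bigr => i _.
by rewrite !mxE /= cnorm2E.
Qed.

Lemma fro2E m n (A : 'M[C]_(m, n)) : fro2 A = dot A A.
Proof. by rewrite /dot fro2C. Qed.

Lemma dotC m n (A B : 'M[C]_(m, n)) : dot A B = dot B A.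
Proof.
have reJ (z : C) : Re (conjc z) = Re z by case: z.
rewrite /dot -reJ -mxtrace_tr -[conjc _]/(conjc _).
rewrite -[B in LHS]adjK -adjM /adj.
rewrite /mxtrace raddf_sum /=; congr Re; apply: eq_bigr => i _.
by rewrite !mxE conjcK.
Qed.

Lemma dotDr m n (A B D : 'M[C]_(m, n)) : dot A (B + D) = dot A B + dot A D.
Proof. by rewrite /dot mulmxDr mxtraceD; case: (\tr _) (\tr _) => ? ? [? ?]. Qed.

Lemma dotNr m n (A B : 'M[C]_(m, n)) : dot A (- B) = - dot A B.
Proof. by rewrite /dot mulmxN raddfN /=; case: (\tr _). Qed.

Lemma dot0r m n (A : 'M[C]_(m, n)) : dot A 0 = 0.
Proof. by rewrite /dot mulmx0 mxtrace0. Qed.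

Lemma dotDl m n (A B D : 'M[C]_(m, n)) : dot (A + B) D = dot A D + dot B D.
Proof. by rewrite dotC dotDr !(dotC D). Qed.

Lemma dotNl m n (A B : 'M[C]_(m, n)) : dot (- A) B = - dot A B.
Proof. by rewrite dotC dotNr dotC. Qed.

Lemma dotMl m n p (A : 'M[C]_(m, n)) (B : 'M[C]_(n, p)) D :
  dot (A *m B) D = dot B (A^h *m D).
Proof. by rewrite /dot adjM mulmxA. Qed.

Lemma dotMr m n p (A : 'M[C]_(m, n)) (B : 'M[C]_(n, p)) D :
  dot (A *m B) D = dot A (D *m B^h).
Proof. by rewrite /dot adjM -mulmxA mxtrace_mulC mulmxA. Qed.

Lemma fro2N m n (A : 'M[C]_(m, n)) : fro2 (- A) = fro2 A.
Proof. by rewrite !fro2E dotNl dotNr opprK. Qed.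

Lemma fro2D m n (A B : 'M[C]_(m, n)) : fro2 (A + B) = fro2 A + fro2 B + 2 * dot A B.
Proof. rewrite !fro2E dotDl !dotDr (dotC B A); ring. Qed.

Lemma fro2B m n (A B : 'M[C]_(m, n)) : fro2 (A - B) = fro2 A + fro2 B - 2 * dot A B.
Proof. by rewrite fro2D fro2N dotNr mulrN. Qed.

(** By the parallelogram law the two sides differ by [fro2 (A - B)]. This replaces the triangle
    inequality throughout and keeps square roots away. *)
Lemma fro2D_le m n (A B : 'M[C]_(m, n)) : fro2 (A + B) <= 2 * fro2 A + 2 * fro2 B.
Proof. have := fro2_ge0 (A - B); rewrite fro2B fro2D; lra. Qed.

Lemma fro2B_le m n (A B : 'M[C]_(m, n)) : fro2 (A - B) <= 2 * fro2 A + 2 * fro2 B.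
Proof. by rewrite -(fro2N B) fro2D_le. Qed.

Lemma fro2BC m n (A B : 'M[C]_(m, n)) : fro2 (A - B) = fro2 (B - A).
Proof. by rewrite -fro2N opprB. Qed.

Lemma fro2_tri m n (B A D : 'M[C]_(m, n)) :
  fro2 (A - D) <= 2 * fro2 (A - B) + 2 * fro2 (B - D).
Proof. by apply: le_trans (fro2D_le _ _); rewrite addrA subrK. Qed.

Lemma fro2_adj m n (A : 'M[C]_(m, n)) : fro2 A^h = fro2 A.
Proof. by rewrite !fro2E /dot adjK mxtrace_mulC. Qed.

Lemma fro2Z m n (a : C) (A : 'M[C]_(m, n)) : fro2 (a *: A) = cnorm2 a * fro2 A.
Proof.
rewrite /fro2 mulr_sumr; apply: eq_bigr => i _; rewrite mulr_sumr.
by apply: eq_bigr => j _; rewrite mxE; case: a (A i j) => a b [c d]; rewrite /cnorm2 /=; ring.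
Qed.

Lemma fro2_isom m n (J : 'M[C]_(m, n)) : isom J -> fro2 J = n%:R.
Proof. by move=> h; rewrite fro2E /dot h mxtrace1 -(rmorph_nat (real_complex R)). Qed.

Lemma fro2_isoml m n p (J : 'M[C]_(m, n)) (A : 'M[C]_(n, p)) :
  isom J -> fro2 (J *m A) = fro2 A.
Proof. by move=> h; rewrite !fro2E dotMl isomK. Qed.

Lemma fro2_isomr m n p (J : 'M[C]_(m, n)) (A : 'M[C]_(p, n)) :
  isom J -> fro2 (A *m J^h) = fro2 A.
Proof. by move=> h; rewrite -fro2_adj adjM adjK fro2_isoml ?fro2_adj. Qed.

Lemma fro2_unitr n p (u : 'M[C]_n) (A : 'M[C]_(p, n)) : isom u -> fro2 (A *m u) = fro2 A.
Proof. by move=> h; rewrite -[u]adjK fro2_isomr //; exact: isom_adj. Qed.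

(** Pythagoras: [J *m (J^h *m A)] is the orthogonal projection of [A] on the range of [J]. *)
Lemma fro2_coisoml m n p (J : 'M[C]_(m, n)) (A : 'M[C]_(m, p)) :
  isom J -> fro2 (J^h *m A) <= fro2 A.
Proof.
move=> h; have := fro2_ge0 (A - J *m (J^h *m A)).
rewrite fro2B fro2_isoml // (dotC A) dotMl -fro2E; lra.
Qed.

Lemma fro2_coisomr m n p (J : 'M[C]_(m, n)) (A : 'M[C]_(p, m)) :
  isom J -> fro2 (A *m J) <= fro2 A.
Proof. by move=> h; rewrite -fro2_adj adjM -(fro2_adj A) fro2_coisoml. Qed.

Lemma fro2_compress m n (J : 'M[C]_(m, n)) (A : 'M[C]_m) :
  isom J -> fro2 (J^h *m A *m J) <= fro2 A.
Proof. by move=> h; apply: le_trans (fro2_coisoml _ h); exact: fro2_coisomr. Qed.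

Lemma fro2_row_mx m n1 n2 (A : 'M[C]_(m, n1)) (B : 'M[C]_(m, n2)) :
  fro2 (row_mx A B) = fro2 A + fro2 B.
Proof.
rewrite /fro2 -big_split; apply: eq_bigr => i _ /=; rewrite big_split_ord /=.
by congr (_ + _); apply: eq_bigr => j _; rewrite ?row_mxEl ?row_mxEr.
Qed.

Lemma fro2_col_mx m1 m2 n (A : 'M[C]_(m1, n)) (B : 'M[C]_(m2, n)) :
  fro2 (col_mx A B) = fro2 A + fro2 B.
Proof.
rewrite /fro2 big_split_ord /=.
by congr (_ + _); apply: eq_bigr => i _; apply: eq_bigr => j _; rewrite ?col_mxEu ?col_mxEd.
Qed.

Lemma fro2_block m1 n1 m2 n2 (A : 'M[C]_(m1, n1)) (B : 'M[C]_(m2, n2)) :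
  fro2 (block_mx A 0 0 B) = fro2 A + fro2 B.
Proof. by rewrite block_mxEh fro2_row_mx !fro2_col_mx !fro20 addr0 add0r. Qed.

Lemma fro2_tens1 d e (A : 'M[C]_d) : fro2 (A *t (1%:M : 'M[C]_e)) = e%:R * fro2 A.
Proof.
rewrite !fro2E /dot adj_tens tensmx_mul adj1 mul1mx.
suff -> (B : 'M[C]_d) : \tr (B *t (1%:M : 'M[C]_e)) = e%:R * \tr B.
  by rewrite fro2C -(rmorph_nat (real_complex R)) -rmorphM.
rewrite -(mxtrace1 C e) mulrC mulr_sum /mxtrace; apply: eq_bigr => i _.
by case: (mxtens_indexP i) => i1 i2; rewrite tensmxE mxtens_indexK.
Qed.

Lemma cauchy_schwarz m n (A B : 'M[C]_(m, n)) :
  dot A B <= Num.sqrt (fro2 A) * Num.sqrt (fro2 B).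
Proof.
have [/eqP|a0] := eqVneq (fro2 A) 0.
  by move=> /eqP /fro2_eq0 ->; rewrite dotC dot0r mulr_ge0 ?sqrtr_ge0.
have [/eqP|b0] := eqVneq (fro2 B) 0.
  by move=> /eqP /fro2_eq0 ->; rewrite dot0r mulr_ge0 ?sqrtr_ge0.
have pa : 0 < Num.sqrt (fro2 A) by rewrite sqrtr_gt0 lt0r a0 fro2_ge0.
have pb : 0 < Num.sqrt (fro2 B) by rewrite sqrtr_gt0 lt0r b0 fro2_ge0.
set a := Num.sqrt _ in pa *; set b := Num.sqrt _ in pb *.
have ea : fro2 A = a ^+ 2 by rewrite sqr_sqrtr.
have eb : fro2 B = b ^+ 2 by rewrite sqr_sqrtr.
have dZ x (D E : 'M[C]_(m, n)) : dot D ((x%:C)%C *: E) = x * dot D E.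
  by rewrite /dot -scalemxAr mxtraceZ; case: (\tr _) => ? ? /=; rewrite mul0r subr0.
(* With a and b the two norms, this square expands to 2ab(ab - [dot A B]). *)
have := fro2_ge0 ((b%:C)%C *: A - (a%:C)%C *: B).
rewrite fro2B !fro2Z dZ dotC dZ ea eb (dotC B) /cnorm2 /=.
set D := dot A B; rewrite [X in 0 <= X -> _](_ : _ = 2 * (a * b) * (a * b - D)); last by ring.
by rewrite pmulr_rge0 ?subr_ge0 // !mulr_gt0.
Qed.

Lemma hsnormE k (x : 'M[C]_k) : hsnorm x = Num.sqrt (fro2 x / k%:R).
Proof. by rewrite /hsnorm mulrC fro2E. Qed.

End Frobenius.

(* Unification otherwise unfolds [adj] when looking for products. *)
#[global] Opaque adj.
#[local] Hint Resolve fro2_ge0 : core.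

(** * Polar decomposition and unitary representations *)

Section Polar.
Variable R : realType.
Local Notation C := R[i].
Local Notation Re := (@complex.Re R).

Lemma isom_square m n (J : 'M[C]_(m, n)) : m = n -> isom J -> J *m J^h = 1%:M.
Proof. by move=> e; move: J; rewrite e => J; exact: unitaryC. Qed.

(** [orthomx] and [schmidt] act on rows, hence the passage to [V = B^h] and back. *)
Lemma isom_complete N r (B : 'M[C]_(N, r)) : isom B ->
  exists r' (B' : 'M[C]_(N, r')),
    [/\ isom B', B^h *m B' = 0, B *m B^h + B' *m B'^h = 1%:M & (r + r')%N = N].
Proof.
move=> hB; pose V := B^h; pose W := orthomx Num.conj 1%:M V.
pose T := schmidt (row_base W).
have Tu : T *m T^h = 1%:M.
  by rewrite -trmxC_adj; apply/unitarymxP/schmidt_unitarymx/rank_leq_col.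
have rV : \rank V = r.
  by apply: mxrank_unitary; apply/unitarymxP; rewrite trmxC_adj adjK.
have rW : (r + \rank W)%N = N by rewrite -rV add_rank_ortho.
have VT : V *m T^h = 0.
  rewrite -trmxC_adj; apply/orthomx1P.
  have : (T <= W)%MS by rewrite eqmx_schmidt_free ?row_base_free // eq_row_base.
  by rewrite orthomx_sym.
have iT : isom T^h by rewrite /isom adjK.
exists (\rank W), T^h; split => //; last first.
have := isom_square (esym rW) (isom_row_mx hB iT VT).
by rewrite adj_row_mx mul_row_col.
Qed.

Lemma isom_diag_le1 n (Z : 'M[C]_n) i : isom Z -> Re (Z i i) <= 1.
Proof.
move=> hZ; have := congr1 (fun X : 'M[C]_n => Re (X i i)) hZ.
rewrite !mxE eqxx raddf_sum (bigD1 i) //= adjE => e.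
have h : 0 <= \sum_(j | j != i) Re (Z^h i j * Z j i).
  by apply: sumr_ge0 => j _; rewrite adjE -cnorm2E cnorm2_ge0.
move: e; rewrite -cnorm2E /cnorm2 /= => e.
have : Re (Z i i) ^+ 2 <= 1 ^+ 2.
  rewrite expr1n -e -addrA lerDl addr_ge0 ?sqr_ge0 //; exact: h.
move=> h1; rewrite leNgt; apply/negP => h2; move: h1; rewrite leNgt => /negP; apply.
by rewrite ltr_pXn2r // ?nnegrE ?ler01 // ltW // (lt_trans ltr01).
Qed.

Lemma gram_diag m n (Y : 'M[C]_(m, n)) i :
  (Y^h *m Y) i i = (\sum_j cnorm2 (Y j i))%:C%C.
Proof. by rewrite mxE raddf_sum; apply: eq_bigr => j _; rewrite adjE -cnorm2E. Qed.

(** [w] is the unitary factor of the polar decomposition of [x]. It is a nearest unitary: [dot x v]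
    is the sum of the singular values weighted by the real parts of diagonal entries of a unitary
    matrix, which are at most 1 and all equal 1 for [v = w]. It commutes with whatever commutes with
    [x] and [x^h], being [x] times a function of [x^h *m x]. *)
Lemma polar n (x u : 'M[C]_n) : x \in unitmx -> isom u ->
  exists w, [/\ isom w, fro2 (x - w) <= fro2 (x - u) &
    forall a, a *m x = x *m a -> a *m x^h = x^h *m a -> a *m w = w *m a].
Proof.
move=> ux hu; have [A AE] : exists A, A = x^h *m x by exists (x^h *m x).
have nA : A \is normalmx.
  by apply/normalmxP; rewrite trmxC_adj AE adjM adjK.
have := elimT (@orthomx_spectralP _ _ A) nA.
have := spectral_unitarymx A; set P := spectralmx A; set sp := spectral_diag A => uP.
have hP : P *m P^h = 1%:M by rewrite -trmxC_adj; apply/unitarymxP.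
have hP' : isom P by exact: mulmx1C.
rewrite invmx_unitary // trmxC_adj => eA.
clearbody P sp.
(* The columns of [y] are orthogonal, and their squared norms [r i] are the eigenvalues of [A]. *)
have [y yE] : exists y, y = x *m P^h by exists (x *m P^h).
have eD : y^h *m y = diag_mx sp.
  rewrite yE adjM adjK !mulmxA -(mulmxA P) -AE eA !mulmxA hP mul1mx.
  by rewrite -!mulmxA hP mulmx1.
pose r i : R := \sum_j cnorm2 (y j i).
have esp i : sp 0 i = (r i)%:C%C.
  have := congr1 (fun X : 'M[C]_n => X i i) eD.
  by rewrite gram_diag !mxE eqxx mulr1n => <-.
have uy : y \in unitmx.
  by rewrite yE unitmx_mul ux; case: (mulmx1_unit hP).
have rp i : 0 < r i.
  rewrite lt0r sumr_ge0 ?andbT; last by move=> ? _; exact: cnorm2_ge0.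
  apply/eqP => ri; have : diag_mx sp \in unitmx.
    by rewrite -eD unitmx_mul uy andbT adj_unitmx.
  rewrite unitmxE det_diag unitfE => /prodf_neq0 /(_ i isT).
  by rewrite esp ri eqxx.
pose s i := Num.sqrt (r i).
have sp0 i : 0 < s i by rewrite sqrtr_gt0.
have s2 i : s i * s i = r i by rewrite -expr2 sqr_sqrtr // ltW.
pose S : 'M[C]_n := diag_mx (\row_i (s i)%:C%C).
pose D : 'M[C]_n := diag_mx (\row_i (s i)^-1%:C%C).
have diagM (f g : 'I_n -> R) :
    diag_mx (\row_i (f i)%:C%C) *m diag_mx (\row_i (g i)%:C%C) =
    diag_mx (\row_i (f i * g i)%:C%C) :> 'M[C]_n.
  rewrite mulmx_diag; congr diag_mx; apply/matrixP => i j.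
  by rewrite !mxE rmorphM.
have diag1 (f : 'I_n -> R) : (forall i, f i = 1) ->
    diag_mx (\row_i (f i)%:C%C) = 1%:M :> 'M[C]_n.
  by move=> h; apply/matrixP => i j; rewrite !mxE h.
have DS : D *m S = 1%:M.
  by rewrite diagM diag1 // => i; rewrite mulVf // gt_eqF.
have Dh : D^h = D.
  apply/matrixP => i j; rewrite adjE !mxE rmorphMn eq_sym /=.
  by case: eqP => [->|_]; rewrite ?mulr0n // oppr0.
have esp' : diag_mx sp = S *m S.
  by rewrite diagM; congr diag_mx; apply/matrixP => i j; rewrite !mxE ord1 esp s2.
have DS' : S *m D = 1%:M by exact: mulmx1C.
have [w wE] : exists w, w = y *m D *m P by eexists; reflexivity.
have hyD : isom (y *m D).
  by rewrite /isom adjM Dh mulmxA -(mulmxA D) eD esp' !mulmxA DS mul1mx.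
have hw : isom w by rewrite wE; exact: isomM.
have Sh : S^h = S.
  apply/matrixP => i j; rewrite adjE !mxE rmorphMn eq_sym /=.
  by case: eqP => [->|_]; rewrite ?mulr0n // oppr0.
have ex : x = w *m P^h *m S *m P.
  rewrite wE -(mulmxA _ P) hP mulmx1 -(mulmxA y) DS mulmx1 yE -mulmxA.
  by rewrite (hP' : P^h *m P = 1%:M) mulmx1.
have dx v : dot x v = \sum_i s i * Re ((P *m w^h *m v *m P^h) i i).
  rewrite {1}ex dotMr -(mulmxA w) dotMl dotMl adjK !mulmxA /dot Sh mul_diag_mx.
  rewrite raddf_sum; apply: eq_bigr => i _; rewrite mxE [X in X * _]mxE.
  by case: (_ i i) => [a b]; rewrite /= mul0r subr0.
exists w; split => //.
  suff : dot x u <= dot x w.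
    by rewrite !fro2B !(fro2_isom hw) !(fro2_isom hu) lerD2l lerN2 ler_pM2l.
  rewrite !dx; apply: ler_sum => i _; rewrite ler_pM2l //.
  rewrite (_ : P *m w^h *m w *m P^h = 1%:M); last first.
    by rewrite -(mulmxA P) hw mulmx1.
  rewrite [X in _ <= Re X]mxE eqxx; apply: isom_diag_le1.
  exact: (isomM (isomM (isomM hP' (isom_adj hw)) hu) (isom_adj hP')).
move=> a ax axh; have [b bE] : exists b, b = P *m a *m P^h by exists (P *m a *m P^h).
have aA : a *m A = A *m a by rewrite AE mulmxA axh -mulmxA ax mulmxA.
have eA' : P *m A *m P^h = S *m S.
  rewrite eA !mulmxA hP mul1mx -mulmxA hP mulmx1; exact: esp'.
have Pa : P *m a = b *m P by rewrite bE -mulmxA (hP' : P^h *m P = _) mulmx1.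
have Pb : P^h *m b = a *m P^h by rewrite bE -(mulmxA P) isomK.
have bS : b *m (S *m S) = S *m S *m b.
  rewrite -eA' -(mulmxA _ _ b) Pb (mulmxA _ a) -(mulmxA P A a) -aA.
  by rewrite (mulmxA P a) Pa !mulmxA.
(* Entrywise, [bS] forces [b i j = 0] unless [r i = r j], and in that case [s i = s j]. *)
have bD : b *m D = D *m b.
  apply/matrixP => i j; have := congr1 (fun X : 'M[C]_n => X i j) bS.
  rewrite diagM mul_mx_diag !mul_diag_mx mul_mx_diag !mxE !s2 => e.
  have [/eqP|/eqP b0] := eqVneq (b i j) 0.
    by move=> /eqP ->; rewrite mul0r mulr0.
  have /mulfI e' : b i j != 0 by apply/eqP.
  by move: e; rewrite [RHS]mulrC => /e' /complexI; rewrite /s => ->; rewrite mulrC.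
clearbody S D.
rewrite wE yE !mulmxA ax -(mulmxA _ P a) Pa mulmxA -(mulmxA _ D b) -bD.
by rewrite mulmxA -(mulmxA x _ b) Pb !mulmxA.
Qed.

Lemma unit_perturb n (x : 'M[C]_n) (eta : R) : 0 < eta ->
  exists t, [/\ 0 < t, t < eta & x + (t%:C%C)%:M \in unitmx].
Proof.
(* The n+1 numbers [f 0], ..., [f n] are distinct, so they cannot all be eigenvalues of [- x]. The
   offset 2 keeps [f 0] strictly below [eta]. *)
move=> e0; pose f (k : nat) : R := eta / k.+2%:R.
have f0 k : 0 < f k by rewrite divr_gt0.
have f1 k : f k < eta by rewrite ltr_pdivrMr // ltr_pMr // ltr1n.
have [[k hk]|/forallNP H] := pselect (exists k, x + ((f k)%:C%C)%:M \in unitmx).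
  by exists (f k).
pose p := char_poly (- x).
pose rs := [seq (f k)%:C%C | k <- iota 0 n.+1] : seq C.
have := @max_poly_roots _ p rs; rewrite size_map size_iota size_char_poly ltnn.
move=> HH; exfalso; suff: false by []; apply: HH.
- by rewrite -size_poly_eq0 size_char_poly.
- apply/allP => z /mapP[k _ ->]; apply: contraT => hz; exfalso; apply: (H k).
  move: hz; rewrite -eigenvalue_root_char /eigenvalue negbK kermx_eq0 row_free_unit.
  by rewrite -opprD -scaleN1r unitmxZ // unitrN1.
- rewrite map_inj_uniq ?iota_uniq // => a b /complexI /(mulfI (lt0r_neq0 e0)).
  by move=> /invr_inj /eqP; rewrite eqr_nat => /eqP [].
Qed.

(** A small scalar is added to [x] to make it invertible; scalars do not affect the commutation
    hypotheses. With e = [fro2 (x - u)], the perturbed matrix is within 4e of [u], hence within 4e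
    of its polar unitary [w], and one more [fro2_tri] gives 16e. *)
Lemma polar_near n (x u : 'M[C]_n) : isom u ->
  exists w, [/\ isom w, fro2 (w - u) <= 16 * fro2 (x - u) &
    forall a, a *m x = x *m a -> a *m x^h = x^h *m a -> a *m w = w *m a].
Proof.
move=> hu; have [e0|e0] := eqVneq (fro2 (x - u)) 0.
  exists u; split => //; first by rewrite subrr fro20 e0 mulr0.
  by move/fro2_eq0/subr0_eq: e0 => ->.
pose e := fro2 (x - u).
have ep : 0 < e by rewrite lt0r e0 fro2_ge0.
(* Chosen so that t^2 n <= t (n+1) < e: the scalar matrix t has squared norm at most e. *)
pose eta := Num.min 1 (e / n.+1%:R).
have eta0 : 0 < eta by rewrite lt_min ltr01 divr_gt0.
have [t [t0 t1 ut]] := unit_perturb x eta0.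
have [w [hw h1 h2]] := polar ut hu.
exists w; split => //; last first.
  move=> a ax axh; apply: h2; first by rewrite mulmxDr mulmxDl ax scalar_mxC.
  by rewrite adjD adj_scalar mulmxDr mulmxDl axh scalar_mxC.
move: t1; rewrite lt_min => /andP[t1]; rewrite ltr_pdivlMr // => t2.
have h3 : fro2 ((t%:C%C)%:M : 'M[C]_n) = t ^+ 2 * n%:R.
  by rewrite -[_%:M]mulmx1 mul_scalar_mx fro2Z (fro2_isom (isom1 _ _)) /cnorm2 /= expr0n addr0.
have h4 : t ^+ 2 * n%:R <= e.
  apply: le_trans (ltW t2); rewrite expr2 -mulrA ler_pM2l //.
  have hn : 0 <= n%:R :> R by [].
  have : n%:R <= n.+1%:R :> R by rewrite ler_nat.
  nra.
have h5 := fro2D_le (x - u) (t%:C%C)%:M; rewrite addrAC in h5.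
have := fro2_tri (x + (t%:C%C)%:M) w u.
rewrite (fro2BC w (x + _)); move: h1 h5; rewrite -/e h3; lra.
Qed.

End Polar.

Section Representations.
Variables (R : realType) (Gm : groupType).
Local Notation C := R[i].
Local Open Scope group_scope.

Definition urep k (pi : Gm -> 'M[C]_k) : Prop :=
  (forall g, isom (pi g)) /\ (forall g h, pi (g * h) = (pi g *m pi h)%R).

Lemma urep1 k (pi : Gm -> 'M[C]_k) : urep pi -> pi 1 = 1%:M%R.
Proof.
move=> [iso mul]; rewrite -[LHS]mul1mx -(iso 1) -mulmxA -mul mulg1.
by [].
Qed.

Lemma urepV k (pi : Gm -> 'M[C]_k) g : urep pi -> pi g^-1 = (pi g)^h.
Proof.
move=> hpi; rewrite -[LHS]mul1mx -(hpi.1 g) -mulmxA -hpi.2 mulgV urep1 //.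
by rewrite mulmx1.
Qed.

Lemma urep_triv k : urep (fun _ : Gm => 1%:M%R : 'M[C]_k).
Proof. by split => [g|g h]; [exact: isom1 | rewrite mul1mx]. Qed.

Lemma urep_sub k r (pi : Gm -> 'M[C]_k) (B : 'M[C]_(k, r)) : urep pi -> isom B ->
  (forall g, pi g *m B = B *m (B^h *m pi g *m B))%R ->
  urep (fun g => B^h *m pi g *m B)%R.
Proof.
move=> [iso mul] hB inv.
have inv' g : B *m (B^h *m (pi g *m B)) = pi g *m B by rewrite [RHS]inv !mulmxA.
split => [g|g h].
  by rewrite /isom !adjM adjK -!mulmxA inv' (mulmxA (pi g)^h) iso mul1mx.
by rewrite mul -!mulmxA inv'.
Qed.

End Representations.

Section Complement.
Variable R : realType.
Local Notation C := R[i].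

(** The hypothesis with [c] says that [x^h] preserves the range of [B]; by duality [x] then
    preserves the orthogonal complement, the range of [B']. *)
Lemma compl_inv N r r' (B : 'M[C]_(N, r)) (B' : 'M[C]_(N, r')) (x : 'M[C]_N) c :
  B^h *m B' = 0 -> B *m B^h + B' *m B'^h = 1%:M -> x^h *m B = B *m c ->
  x *m B' = B' *m (B'^h *m x *m B').
Proof.
move=> h0 h1 hx; rewrite -[LHS]mul1mx -h1 mulmxDl !mulmxA.
suff -> : B *m B^h *m x *m B' = 0 by rewrite add0r.
rewrite -(mulmxA B B^h) -[B^h *m x]adjK adjM adjK hx adjM -!mulmxA h0.
by rewrite !mulmx0.
Qed.

End Complement.

(** * Isotypic components *)

Section Isotypic.
Variables (R : realType) (G : groupType).
Local Notation C := R[i].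

Lemma sum_tens (V : nmodType) m n (F : 'I_(m * n) -> V) :
  \sum_p F p = \sum_i \sum_j F (mxtens_index (i, j)).
Proof.
rewrite pair_big; rewrite (reindex (@mxtens_index m n)) /=.
  by apply: eq_bigr => -[].
by exists (@mxtens_unindex m n) => i _; rewrite (mxtens_indexK, mxtens_unindexK).
Qed.

Lemma tens1_inj d d' e (A B : 'M[C]_(d, d')) : (0 < e)%N ->
  A *t (1%:M : 'M[C]_e) = B *t 1%:M -> A = B.
Proof.
case: e => // e _ h; apply/matrixP => i j.
have := congr1 (fun X : 'M[C]_(d * e.+1, d' * e.+1) =>
  X (mxtens_index (i, ord0)) (mxtens_index (j, ord0))) h.
by rewrite !tensmxE mxE eqxx !mulr1.
Qed.

Lemma inv_range k r (a : 'M[C]_k) (B : 'M[C]_(k, r)) X : isom B ->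
  a *m B = B *m X -> a *m B = B *m (B^h *m a *m B).
Proof. by move=> hB h; rewrite -mulmxA h isomK. Qed.

(** [T] parametrizes an invariant subspace of dimension [e'], so irreducibility is expressed by
    comparing dimensions. *)
Definition irreducible_rep e (sigma : G -> 'M[C]_e) : Prop :=
  forall e' (T : 'M[C]_(e, e')), (0 < e')%N -> isom T ->
    (forall g, exists X, sigma g *m T = T *m X) -> (e <= e')%N.

(** An eigenspace of [a] is invariant, hence everything. Eigenspaces consist of rows, so it is
    [T0^h] that spans an invariant subspace of columns, by unitarity of [sigma]. *)
Lemma schur_scalar e (sigma : G -> 'M[C]_e) a : (0 < e)%N ->
  urep sigma -> irreducible_rep sigma ->
  (forall g, sigma g *m a = a *m sigma g) -> exists l, a = l%:M.
Proof.
move=> e0 us irr ca; have [l hl] := eigenvalue_closed a e0.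
exists l; pose K := eigenspace a l; pose T0 := schmidt (row_base K).
have K0 : (0 < \rank K)%N by rewrite lt0n mxrank_eq0.
have eT : (T0 :=: K)%MS.
  by apply: eqmx_trans (eq_row_base K); apply: eqmx_schmidt_free; exact: row_base_free.
have uT : T0 *m T0^h = 1%:M.
  by rewrite -trmxC_adj; apply/unitarymxP/schmidt_unitarymx/rank_leq_col.
have hT : isom T0^h by rewrite /isom adjK.
have Ta : T0 *m a = l *: T0 by apply/eigenspaceP; rewrite eT.
have inv g : exists X, sigma g *m T0^h = T0^h *m X.
  have /submxP[X hX] : (T0 *m sigma g^-1%g <= T0)%MS.
    by rewrite eT; apply/eigenspaceP; rewrite -mulmxA ca mulmxA Ta scalemxAl.
  by exists X^h; rewrite -adjM -hX adjM urepV // adjK.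
have er := irr _ _ K0 hT inv.
have re : e = \rank K by apply/eqP; rewrite eqn_leq er rank_leq_col.
have := isom_square re hT; rewrite adjK => TT.
by rewrite -[a]mul1mx -TT -mulmxA Ta -scalemxAr TT scalemx1.
Qed.

Section Multiplicity.
Variables (k e : nat) (pi : G -> 'M[C]_k) (sigma : G -> 'M[C]_e).
Hypotheses (upi : urep pi) (us : urep sigma) (irr : irreducible_rep sigma).
Hypothesis e0 : (0 < e)%N.

Definition intertwiner (T : 'M[C]_(k, e)) : Prop :=
  forall g, pi g *m T = T *m sigma g.

Definition intertwiner_family d (S : 'I_d -> 'M[C]_(k, e)) : Prop :=
  (forall i, intertwiner (S i)) /\
  (forall i j, (S i)^h *m S j = ((i == j)%:R)%:M).

(** The maps [S i] side by side, read as one map from C^d (x) C^e to C^k. *)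
Definition mxfamily d (S : 'I_d -> 'M[C]_(k, e)) : 'M[C]_(k, d * e) :=
  \matrix_(a, p) S (mxtens_unindex p).1 a (mxtens_unindex p).2.

Lemma mxfamilyE d (S : 'I_d -> 'M[C]_(k, e)) a i b :
  mxfamily S a (mxtens_index (i, b)) = S i a b.
Proof. by rewrite mxE mxtens_indexK. Qed.

Lemma mul_mxfamily d (S : 'I_d -> 'M[C]_(k, e)) (x : 'M[C]_k) :
  x *m mxfamily S = mxfamily (fun i => x *m S i).
Proof. by apply/matrixP => a p; rewrite !mxE; apply: eq_bigr => j _; rewrite mxE. Qed.

Lemma mxfamily_tens d d' (S : 'I_d -> 'M[C]_(k, e)) (c : 'M[C]_(d, d')) (B : 'M[C]_e) :
  mxfamily S *m (c *t B) = mxfamily (fun j => \sum_i c i j *: (S i *m B)).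
Proof.
apply/matrixP => a p; case: (mxtens_indexP p) => j b {p}.
rewrite mxfamilyE mxE sum_tens summxE; apply: eq_bigr => i _.
rewrite !mxE mulr_sumr; apply: eq_bigr => l _.
by rewrite mxfamilyE tensmxE mulrCA.
Qed.

Lemma isom_mxfamily d (S : 'I_d -> 'M[C]_(k, e)) :
  intertwiner_family S -> isom (mxfamily S).
Proof.
move=> [_ hS]; apply/matrixP => p q.
case: (mxtens_indexP p) => i a; case: (mxtens_indexP q) => j b {p q}.
have := congr1 (fun X : 'M[C]_e => X a b) (hS i j).
rewrite !mxE (can_eq (@mxtens_indexK _ _)) xpair_eqE => h.
transitivity ((i == j)%:R *+ (a == b) : C); last by case: eqP; case: eqP.
by rewrite -h; apply: eq_bigr => x _; rewrite !adjE !mxfamilyE.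
Qed.

Lemma mxfamily_rep d (S : 'I_d -> 'M[C]_(k, e)) g : intertwiner_family S ->
  pi g *m mxfamily S = mxfamily S *m (1%:M *t sigma g).
Proof.
move=> [hS _]; rewrite mul_mxfamily mxfamily_tens.
apply/matrixP => a p; case: (mxtens_indexP p) => j b {p}.
rewrite !mxfamilyE hS (bigD1 j) //= big1 ?addr0 ?mxE ?eqxx ?mul1r ?mxE //.
by move=> i /negPf ij; rewrite mxE ij scale0r.
Qed.

(** [S^h *m T] commutes with [sigma], so Schur applies: the scalar [l] is an inner product on the
    space of intertwiners. *)
Lemma intertwiner_gram S T : intertwiner S -> intertwiner T ->
  exists l, S^h *m T = l%:M.
Proof.
move=> hS hT; apply: (schur_scalar e0 us irr) => g.
rewrite -mulmxA -hT mulmxA -[sigma g]adjK -adjM -urepV // -hS adjM.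
by rewrite urepV // adjK mulmxA.
Qed.

Lemma intertwiner_lin S T a : intertwiner S -> intertwiner T ->
  intertwiner (S + a *: T).
Proof.
by move=> hS hT g; rewrite mulmxDr mulmxDl -scalemxAl -scalemxAr hS hT.
Qed.

Lemma intertwiner0 : intertwiner 0.
Proof. by move=> g; rewrite mulmx0 mul0mx. Qed.

Lemma intertwiner_sum d (S : 'I_d -> 'M[C]_(k, e)) (l : 'I_d -> C) :
  (forall i, intertwiner (S i)) -> intertwiner (\sum_i l i *: S i).
Proof.
move=> hS; elim/big_rec: _ => [|i x _ hx]; first exact: intertwiner0.
by rewrite addrC; exact: intertwiner_lin.
Qed.

Lemma intertwiner_extend d (S : 'I_d -> 'M[C]_(k, e)) T :
  intertwiner_family S -> intertwiner T -> T != 0 ->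
  (forall i, (S i)^h *m T = 0) ->
  exists S' : 'I_d.+1 -> 'M[C]_(k, e), intertwiner_family S'.
Proof.
move=> [hS oS] hT T0 ST; have [l hl] := intertwiner_gram hT hT.
have er : 0 < e%:R :> R by rewrite ltr0n.
(* Comparing traces in [T^h *m T = l%:M] identifies the factor by which [T] must be normalized. *)
have lE : l = (fro2 T / e%:R)%:C%C.
  have := fro2C T; rewrite hl mxtrace_scalar => h.
  have eC : e%:R != 0 :> C by rewrite pnatr_eq0 -lt0n.
  apply: (mulIf eC); rewrite mulr_natr h -(rmorph_nat (real_complex R)) -rmorphM /=.
  by rewrite divfK // gt_eqF.
pose r := fro2 T / e%:R.
have r0 : 0 < r.
  rewrite divr_gt0 // lt0r fro2_ge0 andbT; apply: contra T0 => /eqP /fro2_eq0 ->.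
  by [].
pose s : C := ((Num.sqrt r)^-1)%:C%C.
have sr : conjc s * s * l = 1.
  rewrite lE -/r /s conjc_real -!rmorphM /= -expr2 exprVn sqr_sqrtr ?ltW //.
  by rewrite mulVf // gt_eqF.
pose S' (i : 'I_d.+1) := if unlift ord_max i is Some j then S j else s *: T.
exists S'; split.
  move=> i g; rewrite /S'; case: unliftP => [j _|_]; first exact: hS.
  by rewrite -scalemxAl -scalemxAr hT.
move=> i j; rewrite /S'; case: unliftP => [i' ->|->]; case: unliftP => [j' ->|->].
- by rewrite oS (inj_eq lift_inj).
- by rewrite -scalemxAr ST scaler0 eq_sym (negPf (neq_lift _ _)) raddf0.
- rewrite adjZ -scalemxAl -[T^h *m _]adjK adjM adjK ST adj0 scaler0.
  by rewrite (negPf (neq_lift _ _)) raddf0.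
- rewrite adjZ -scalemxAl -scalemxAr hl -!mul_scalar_mx -!scalar_mxM.
  by rewrite mulrA sr eqxx.
Qed.

(** Orthonormal families of intertwiners have at most k members, since [mxfamily] makes them
    isometries. For a longest one, subtracting from [T] its projections leaves zero, or the family
    could be extended. *)
Lemma max_family S0 : intertwiner S0 -> isom S0 ->
  exists d (S : 'I_d -> 'M[C]_(k, e)), [/\ (0 < d)%N, intertwiner_family S &
    forall T, intertwiner T -> exists l, T = \sum_i l i *: S i].
Proof.
move=> h0 i0; pose P d := `[< exists S : 'I_d -> 'M[C]_(k, e), intertwiner_family S >].
have P1 : P 1%N.
  apply/asboolP; exists (fun _ => S0); split => // i j.
  by rewrite !ord1 eqxx i0.
have Pk d : P d -> (d <= k)%N.
  move=> /asboolP[S /isom_mxfamily /isom_leq]; apply: leq_trans.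
  exact: leq_pmulr.
have exP : exists d, P d by exists 1%N.
have [d /asboolP[S hS] hd] := ex_maxnP exP Pk.
exists d, S; split => //; first exact: hd.
move=> T hT; have [hS1 hS2] := hS.
have /choice[l hl] i : exists l, (S i)^h *m T = l%:M by exact: intertwiner_gram.
exists l; apply/eqP; rewrite -subr_eq0; apply: contraT => N0.
have := @intertwiner_extend d S _ hS _ N0 _; case.
- rewrite -scaleN1r; apply: intertwiner_lin => //; exact: intertwiner_sum.
- move=> i; rewrite mulmxBr hl mulmx_sumr (bigD1 i) //= big1 ?addr0.
    by rewrite -scalemxAr hS2 eqxx scalemx1 subrr.
  by move=> j ji; rewrite -scalemxAr hS2 eq_sym (negPf ji) raddf0 scaler0.
- move=> S' hS'; suff : (d.+1 <= d)%N by rewrite ltnn.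
  by apply: hd; apply/asboolP; exists S'.
Qed.

End Multiplicity.

(* [W] identifies the isotypic component of the irreducible [sigma] with C^d (x) C^e. *)
Lemma isotypic k (pi : G -> 'M[C]_k) : (0 < k)%N -> urep pi ->
  exists d e (sigma : G -> 'M[C]_e) (W : 'M[C]_(k, d * e)),
    [/\ (0 < d)%N, (0 < e)%N, urep sigma, isom W &
      (forall g, pi g *m W = W *m (1%:M *t sigma g)) /\
      (forall x, (forall g, pi g *m x = x *m pi g) ->
         exists c : 'M[C]_d, x *m W = W *m (c *t 1%:M))].
Proof.
move=> k0 upi.
(* An invariant subspace of least positive dimension carries an irreducible representation. *)
pose P e := `[< (0 < e)%N /\ exists S : 'M[C]_(k, e), isom S /\
  forall g, exists X, pi g *m S = S *m X >].
have Pk : P k.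
  apply/asboolP; split => //; exists 1%:M; split; first exact: isom1.
  by move=> g; exists (pi g); rewrite mulmx1 mul1mx.
have exP : exists e, P e by exists k.
have [e /asboolP[e0 [S [hS Sinv]]] emin] := ex_minnP exP.
have Sinv' g : pi g *m S = S *m (S^h *m pi g *m S).
  by have [X hX] := Sinv g; exact: inv_range hX.
pose sigma g := S^h *m pi g *m S.
have us : urep sigma by exact: urep_sub.
have irr : irreducible_rep sigma.
  move=> e' T e'0 hT inv; apply: emin; apply/asboolP; split => //.
  exists (S *m T); split; first exact: isomM.
  by move=> g; have [X hX] := inv g; exists X; rewrite mulmxA Sinv' -(mulmxA S T) -hX [RHS]mulmxA.
have [d [F [d0 hF span]]] := @max_family k e pi sigma upi us irr e0 S Sinv' hS.
exists d, e, sigma, (mxfamily F); split => //; first exact: (isom_mxfamily hF).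
split; first by move=> g; exact: (mxfamily_rep _ hF).
move=> x cx.
(* Left multiplication by [x] preserves intertwiners; [l] records its matrix in the basis [F], and
   this matrix is [c]. *)
have /choice[l hl] j : exists l, x *m F j = \sum_i l i *: F i.
  by apply: span => g; rewrite mulmxA cx -mulmxA hF.1 mulmxA.
exists (\matrix_(i, j) l j i); rewrite mul_mxfamily mxfamily_tens.
apply/matrixP => a p; case: (mxtens_indexP p) => j b.
rewrite !mxfamilyE hl; congr ((_ : 'M[C]__) a b); apply: eq_bigr => i _.
by rewrite mxE mulmx1.
Qed.

End Isotypic.

(** * Correction inside a commutant *)

Section Amplification.
Variables (R : realType) (G H : groupType).
Local Notation C := R[i].
Variables (b : bool) (F : seq H) (F' : seq (H * H)) (eps K : R).

(** The growth of the dimension is charged together with the errors, so a single estimate controls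
    both requirements of flexible stability. *)
Definition cost d d' (chi : H -> 'M[C]_d) (chi' : H -> 'M[C]_d') (J : 'M[C]_(d', d)) : R :=
  \sum_(h <- F) fro2 (chi h - J^h *m chi' h *m J) + (d'%:R - d%:R).

Definition defect d (chi : H -> 'M[C]_d) : R :=
  \sum_(p <- F') fro2 (chi (p.1 * p.2)%g - chi p.1 *m chi p.2).

(* A linear form of stability: being additive over direct sums, it survives the
   passage from matrix algebras to commutants. *)
Definition correctable : Prop :=
  forall d (chi : H -> 'M[C]_d), (forall h, isom (chi h)) ->
    exists d' (chi' : H -> 'M[C]_d') (J : 'M[C]_(d', d)),
      [/\ urep chi', isom J, b -> d' = d &
          cost chi chi' J <= eps * d%:R + K * defect chi].

Definition correctable_commutant k (pi : G -> 'M[C]_k) (psi : H -> 'M[C]_k) : Prop :=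
  exists k' (pi' : G -> 'M[C]_k') (rho : H -> 'M[C]_k') (J : 'M[C]_(k', k)),
    [/\ urep pi' /\ urep rho, forall g h, pi' g *m rho h = rho h *m pi' g,
        isom J /\ (b -> k' = k), forall g, pi' g *m J = J *m pi g &
        cost psi rho J <= eps * k%:R + K * defect psi].

Section Block.
Variables (k d e k2 : nat) (U : 'M[C]_(k, d * e + k2)).
Hypotheses (UU : isom U) (UU' : U *m U^h = 1%:M).

Definition blk (A : 'M[C]_d) (B : 'M[C]_k2) : 'M[C]_k :=
  U *m block_mx (A *t (1%:M : 'M[C]_e)) 0 0 B *m U^h.

Lemma blkM A B A' B' : blk A B *m blk A' B' = blk (A *m A') (B *m B').
Proof.
rewrite /blk !mulmxA -(mulmxA _ U^h U) UU mulmx1 -(mulmxA U) mulmx_block.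
by rewrite !(mulmx0, mul0mx) !addr0 !add0r tensmx_mul mulmx1.
Qed.

Lemma blkB A B A' B' : blk A B - blk A' B' = blk (A - A') (B - B').
Proof.
rewrite /blk -mulmxBl -mulmxBr; congr (_ *m _ *m _).
rewrite opp_block_mx add_block_mx !subrr; congr block_mx.
apply/matrixP => i j; case: (mxtens_indexP i) => i1 i2; case: (mxtens_indexP j) => j1 j2.
by rewrite !mxE !mxtens_indexK mulrBl.
Qed.

Lemma fro2_blk A B : fro2 (blk A B) = e%:R * fro2 A + fro2 B.
Proof.
rewrite /blk fro2_isomr ?fro2_isoml //; first by rewrite fro2_block fro2_tens1.
Qed.

End Block.

(** Induction on k, splitting off one isotypic component. There [psi h] is [c h *t 1%:M]; a
    correction of [c], tensored with 1_e, costs e times as much, the defect of [c] also counts e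
    times, and e d + k2 = k. *)
Theorem amplification : correctable ->
  forall k (pi : G -> 'M[C]_k) (psi : H -> 'M[C]_k), urep pi ->
    (forall h, isom (psi h)) -> (forall g h, pi g *m psi h = psi h *m pi g) ->
    correctable_commutant pi psi.
Proof.
move=> corr; elim/ltn_ind => k IH pi psi upi ipsi com.
have [k0|k0] := posnP k.
  have z m (A B : 'M[C]_(m, k)) : A = B.
    by apply/matrixP => i j; exfalso; move: j; rewrite k0 => -[].
  exists k, pi, (fun _ => 1%:M), 1%:M; split.
  - by split => //; exact: urep_triv.
  - by move=> g h; exact: z.
  - by split => //; exact: isom1.
  - by move=> g; exact: z.
  have kE : k%:R = 0 :> R by rewrite k0.
  rewrite /cost /defect subrr kE mulr0 add0r addr0 !big1 ?mulr0 // => i _.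
    by rewrite [X in fro2 X](z _ _ 0) fro20.
  by rewrite [X in fro2 X](z _ _ 0) fro20.
have [d [e [sigma [W [d0 e0 us hW [piW span]]]]]] := isotypic k0 upi.
have [k2 [W' [hW' oW cW sk]]] := isom_complete hW.
have pi2E g : pi g *m W' = W' *m (W'^h *m pi g *m W').
  by apply: (compl_inv oW cW (c := 1%:M *t sigma g^-1%g)); rewrite -urepV.
pose pi2 g := W'^h *m pi g *m W'.
have upi2 : urep pi2 by exact: urep_sub.
have /choice[c cE] h : exists c : 'M[C]_d, psi h *m W = W *m (c *t 1%:M).
  by apply: span.
(* The adjoints must preserve the range of [W] too, for [psi h] to preserve its complement. *)
have /choice[c' c'E] h : exists c : 'M[C]_d, (psi h)^h *m W = W *m (c *t 1%:M).
  apply: span => g; rewrite -[pi g]adjK -!adjM -urepV //; congr (_^h).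
  by rewrite com.
have psi2E h : psi h *m W' = W' *m (W'^h *m psi h *m W').
  exact: (compl_inv oW cW (c'E h)).
pose psi2 h := W'^h *m psi h *m W'.
pose U := row_mx W W'.
have UU : isom U by exact: isom_row_mx.
have UU' : U *m U^h = 1%:M by exact: (isom_square (esym sk) UU).
have psiB h : psi h = blk U (c h) (psi2 h).
  rewrite /blk -[LHS]mulmx1 -UU' mulmxA; congr (_ *m _).
  by rewrite mul_mx_row mul_row_block !mulmx0 addr0 add0r cE psi2E.
have Upi g : U^h *m pi g = block_mx (1%:M *t sigma g) 0 0 (pi2 g) *m U^h.
  rewrite -[LHS]mulmx1 -UU' !mulmxA; congr (_ *m _); rewrite -mulmxA.
  rewrite mul_mx_row piW pi2E -/(pi2 g).
  transitivity (U^h *m (U *m block_mx (1%:M *t sigma g) 0 0 (pi2 g))).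
    by rewrite mul_row_block !mulmx0 addr0 add0r.
  by rewrite isomK.
have ic h : isom (c h).
  have := isomM (ipsi h) hW; rewrite cE /isom adjM -mulmxA isomK //.
  by rewrite adj_tens adj1 tensmx_mul mulmx1 -tens11 => /(tens1_inj e0).
have ipsi2 h : isom (psi2 h).
  rewrite /isom /psi2 !adjM adjK -!mulmxA.
  have -> : W' *m (W'^h *m (psi h *m W')) = psi h *m W' by rewrite [RHS]psi2E !mulmxA.
  by rewrite (mulmxA (psi h)^h) ipsi mul1mx.
have com2 g h : pi2 g *m psi2 h = psi2 h *m pi2 g.
  rewrite /pi2 /psi2 -!mulmxA.
  have -> : W' *m (W'^h *m (psi h *m W')) = psi h *m W' by rewrite [RHS]psi2E !mulmxA.
  have -> : W' *m (W'^h *m (pi g *m W')) = pi g *m W' by rewrite [RHS]pi2E !mulmxA.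
  by rewrite !(mulmxA (pi g)) !(mulmxA (psi h)) com.
have k2k : (k2 < k)%N by rewrite -sk -[X in (X < _)%N]add0n ltn_add2r muln_gt0 d0.
have [k2' [pi2' [rho2 [J2 [[upi2' urho2] com2' [hJ2 k2E] J2E cost2]]]]] :=
  IH k2 k2k pi2 psi2 upi2 ipsi2 com2.
have [d' [chi [J1 [uchi hJ1 dE cost1]]]] := corr d c ic.
pose B := block_mx (J1 *t (1%:M : 'M[C]_e)) 0 0 J2.
have hB : isom B by apply: isom_block => //; apply: isom_tens => //; exact: isom1.
(* The additional dimensions of [chi] carry further copies of [sigma], so the enlarged
   representation of [G] still commutes with that of [H]. *)
exists (d' * e + k2')%N, (fun g => block_mx (1%:M *t sigma g) 0 0 (pi2' g)),
  (fun h => block_mx (chi h *t 1%:M) 0 0 (rho2 h)), (B *m U^h); split.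
- split; split => [g|g h].
  + by apply: isom_block (upi2'.1 g); apply: isom_tens (us.1 g); exact: isom1.
  + rewrite mulmx_block !(mulmx0, mul0mx) !addr0 !add0r tensmx_mul mulmx1.
    by rewrite us.2 upi2'.2.
  + by apply: isom_block (urho2.1 g); apply: isom_tens (uchi.1 g) _; exact: isom1.
  + rewrite mulmx_block !(mulmx0, mul0mx) !addr0 !add0r tensmx_mul mulmx1.
    by rewrite uchi.2 urho2.2.
- move=> g h; rewrite !mulmx_block !(mulmx0, mul0mx) !addr0 !add0r !tensmx_mul.
  by rewrite !mulmx1 !mul1mx com2'.
- split; last by move=> hb; rewrite dE // k2E.
  by apply: isomM => //; rewrite /isom adjK.
- move=> g; rewrite mulmxA -(mulmxA B) Upi mulmxA; congr (_ *m _).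
  rewrite /B !mulmx_block !(mulmx0, mul0mx) !addr0 !add0r !tensmx_mul.
  by rewrite !mulmx1 !mul1mx J2E.
have rhoB h : (B *m U^h)^h *m block_mx (chi h *t 1%:M) 0 0 (rho2 h) *m (B *m U^h) =
    blk U (J1^h *m chi h *m J1) (J2^h *m rho2 h *m J2).
  rewrite /blk adjM adjK !mulmxA -!(mulmxA U); congr (_ *m (_ *m _)).
  rewrite /B adj_block_mx !adj0 adj_tens adj1.
  rewrite !mulmx_block !(mulmx0, mul0mx) !addr0 !add0r !tensmx_mul !mulmx1.
  by rewrite !mul0mx.
have -> : cost psi (fun h => block_mx (chi h *t 1%:M) 0 0 (rho2 h)) (B *m U^h) =
    e%:R * cost c chi J1 + cost psi2 rho2 J2.
  rewrite /cost (eq_bigr (fun h => e%:R * fro2 (c h - J1^h *m chi h *m J1) +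
      fro2 (psi2 h - J2^h *m rho2 h *m J2))).
    rewrite big_split -mulr_sumr -[in X in _ - X]sk !natrD !natrM /=.
    by set s1 := \sum_(_ <- _) _; set s2 := \sum_(_ <- _) _; ring.
  by move=> h _; rewrite rhoB psiB blkB // fro2_blk.
have -> : defect psi = e%:R * defect c + defect psi2.
  rewrite /defect mulr_sumr -big_split; apply: eq_bigr => -[h h'] _ /=.
  by rewrite !psiB blkM // blkB // fro2_blk.
rewrite -[in X in eps * X]sk natrD natrM.
move: cost1 => /(ler_wpM2l (ler0n R e)); move: cost2.
move: (cost _ _ _) (cost _ _ _) (defect _) (defect _) => x y z t h1 h2.
apply: le_trans (lerD h2 h1) _; rewrite le_eqVlt; apply/orP; left; apply/eqP; ring.
Qed.

End Amplification.

(** * Property (T) and finite-dimensional representations *)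

Section InvariantVectors.
Variables (R : realType) (G : groupType).
Local Notation C := R[i].

(** The columns of [B] form a longest orthonormal system of fixed vectors. A fixed vector in the
    complement [B'] could be normalized and appended to it, and the projection on the range of [B]
    is fixed. *)
Lemma split_invariants N (U : G -> 'M[C]_N) : urep U ->
  exists N' (U' : G -> 'M[C]_N') (B' : 'M[C]_(N, N')),
    [/\ urep U', isom B', forall g, U g *m B' = B' *m U' g,
        forall v : 'cV[C]_N', (forall g, U' g *m v = v) -> v = 0 &
        forall (x : 'cV[C]_N) g, U g *m (x - B' *m (B'^h *m x)) = x - B' *m (B'^h *m x)].
Proof.
move=> uU; pose P r := `[< exists B : 'M[C]_(N, r), isom B /\ forall g, U g *m B = B >].
have exP : exists r, P r.
  exists 0%N; apply/asboolP; exists 0; split; last by move=> g; rewrite mulmx0.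
  by apply/matrixP => -[].
have bP r : P r -> (r <= N)%N by move=> /asboolP[B [/isom_leq]].
have [r /asboolP[B [hB Binv]] rmax] := ex_maxnP exP bP.
have [N' [B' [hB' oB cB _]]] := isom_complete hB.
have UB' g : U g *m B' = B' *m (B'^h *m U g *m B').
  by apply: (compl_inv oB cB (c := 1%:M)); rewrite -urepV // Binv mulmx1.
exists N', (fun g => B'^h *m U g *m B'), B'; split => //; first exact: urep_sub.
- move=> v hv; apply/eqP; apply: contraT => v0.
  have fv : 0 < fro2 v.
    by rewrite lt0r fro2_ge0 andbT; apply: contra v0 => /eqP /fro2_eq0 ->.
  pose s : C := ((Num.sqrt (fro2 v))^-1)%:C%C.
  pose B1 := row_mx B (s *: (B' *m v)).
  suff : (r + 1 <= r)%N by rewrite addn1 ltnn.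
  apply: rmax; apply/asboolP; exists B1; split; last first.
    move=> g; rewrite /B1 mul_mx_row Binv -scalemxAr mulmxA UB'.
    by rewrite -(mulmxA B') hv.
  have e1 : B^h *m (s *: (B' *m v)) = 0 by rewrite -scalemxAr mulmxA oB mul0mx scaler0.
  apply: isom_row_mx => //; rewrite /isom.
  rewrite adjZ -scalemxAl -scalemxAr adjM -mulmxA isomK // [v^h *m v]mx11_scalar.
  rewrite -trace_mx11 fro2C -!mul_scalar_mx -!scalar_mxM; congr _%:M.
  rewrite /s conjc_real -!rmorphM /= mulrA -expr2 exprVn sqr_sqrtr ?ltW //.
  by rewrite mulVf // gt_eqF.
- move=> x g; rewrite mulmxA -{1 3}[x]mul1mx -cB mulmxDl addrK.
  by rewrite !mulmxA Binv.
Qed.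

End InvariantVectors.

Lemma countable_enum (G : groupType) : countable_group G ->
  exists e : nat -> seq G, (forall m n, (m <= n)%N -> {subset e m <= e n}) /\
    forall g, exists n, g \in e n.
Proof.
move=> [f fI].
pose sel i := if pselect (exists g, f g = i) is left p then Some (projT1 (cid p)) else None.
have selE g : sel (f g) = Some g.
  rewrite /sel; case: pselect => [p|[]]; last by exists g.
  by congr Some; apply: fI; exact: (projT2 (cid p)).
exists (fun n => pmap sel (iota 0 n)); split.
  by move=> m n mn g gm; rewrite -(subnKC mn) iotaD pmap_cat mem_cat gm.
move=> g; exists (f g).+1; rewrite mem_pmap -selE; apply: map_f.
by rewrite mem_iota add0n ltnS leqnn.
Qed.

(** * Direct sums of finite-dimensional representations, realized on l^2(N) *)

Section SquareSummable.
Variable R : realType.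
Local Notation C := R[i].

(** With extended real values the sum always exists and may be rearranged freely; [l2P] recovers
    summability as finiteness. *)
Definition energy (x : nat -> C) : \bar R := (\sum_(i <oo) (cnorm2 (x i))%:E)%E.

Lemma energyE x : l2 x -> energy x = (limn (series (fun i => cnorm2 (x i))))%:E.
Proof.
move=> hx; rewrite -EFin_lim //; congr (limn _); apply/funext => n /=.
by rewrite sumEFin.
Qed.

Lemma l2P (x : nat -> C) : l2 x <-> (energy x < +oo)%E.
Proof.
split=> [hx|hx]; first by rewrite energyE // ltry.
apply: nondecreasing_is_cvgn.
  by apply: nondecreasing_series => i _ _; exact: cnorm2_ge0.
exists (fine (energy x)) => _ [n _ <-].
have e0 : (0 <= energy x)%E by apply: nneseries_ge0 => i _ _; rewrite lee_fin cnorm2_ge0.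
rewrite -lee_fin fineK ?ge0_fin_numE // /series /= -sumEFin.
by apply: nneseries_lim_ge => i _ _; rewrite lee_fin cnorm2_ge0.
Qed.

Lemma l2normE (x : nat -> C) (r : R) : energy x = r%:E -> l2 x /\ l2norm x = Num.sqrt r.
Proof.
move=> h; have hx : l2 x by apply/l2P; rewrite h ltry.
split=> //; rewrite /l2norm; congr Num.sqrt.
by move: h; rewrite energyE // => -[].
Qed.

Lemma energy_l2norm (x y : nat -> C) : l2 x -> energy y = energy x ->
  l2 y /\ l2norm y = l2norm x.
Proof.
move=> hx h; have hy : l2 y by apply/l2P; rewrite h; apply/l2P.
split=> //; rewrite /l2norm; congr Num.sqrt.
by move: h; rewrite !energyE // => -[].
Qed.

Section Blocks.
Variable N : nat -> nat.
Hypothesis N0 : forall n, (0 < N n)%N.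
Local Notation I := {n : nat & 'I_(N n)}.
Local Notation index := (Tagged (fun n => 'I_(N n))).

(** [propertyT] is tested on sequences indexed by [nat], so the coordinates of the direct sum have
    to be enumerated. Nonempty blocks make their number infinite. *)
Lemma block_bij : exists f : I -> nat, bijective f.
Proof.
have : ([set: I] #= [set: nat])%card.
  apply: eq_card_nat; first exact: countableP.
  move=> /(finite_image (@tag _ _)) h; apply: infinite_nat; apply: sub_finite_set h.
  by move=> n _; exists (index (Ordinal (N0 n))).
by move=> /card_set_bijP[f]; rewrite setTT_bijective => bf; exists f.
Qed.

Lemma esum_ord m (a : 'I_m -> \bar R) : (forall i, 0 <= a i)%E ->
  (\esum_(i in [set: 'I_m]) a i = \sum_i a i)%E.
Proof.
have fI : finite_set [set: 'I_m] by exact: finite_finset.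
move=> a0; rewrite esum_fset // [RHS]fsbig_seq ?index_enum_uniq //.
by apply: eq_fsbigl; apply/seteqP; split => i //= _; exact: mem_index_enum.
Qed.

Lemma nneseries_blocks (f : I -> nat) (a : nat -> \bar R) : bijective f ->
  (forall i, 0 <= a i)%E ->
  (\sum_(i <oo) a i = \sum_(n <oo) \sum_(b < N n) a (f (index b)))%E.
Proof.
move=> bf a0; rewrite nneseries_esumT //.
rewrite nneseries_esumT; last by move=> n; apply: sume_ge0.
rewrite (@reindex_esum _ _ _ [set: I] _ f); last by rewrite setTT_bijective.
pose J (n : nat) : set I := [set p | tag p = n]%classic.
have -> : ([set: I] = \bigcup_(n in [set: nat]) J n)%classic.
  by apply/seteqP; split => p // _; exists (tag p).
rewrite esum_bigcupT //; last by move=> m n _ _ [p [<- <-]].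
apply: eq_esum => n _; rewrite -esum_ord //.
apply: (@reindex_esum _ _ _ _ _ (fun b : 'I_(N n) => index b)).
split.
- by move=> b.
- by move=> b c _ _ /eqP; rewrite -tag_eqE /tag_eq /= eqxx tagged_asE => /eqP.
- by move=> [m b] /= e; rewrite /J /= in e; subst n; exists b.
Qed.

Section DirectSum.
Variables (f : I -> nat) (f' : nat -> I).
Hypotheses (fK : cancel f f') (f'K : cancel f' f).

Definition block (x : nat -> C) n : 'cV[C]_(N n) := \col_b x (f (index b)).
Definition unblock (w : forall n, 'cV[C]_(N n)) : nat -> C :=
  fun i => w (tag (f' i)) (tagged (f' i)) 0.

Lemma unblockK w n : block (unblock w) n = w n.
Proof. by apply/matrixP => b j; rewrite mxE /unblock fK ord1. Qed.

Lemma blockK x : unblock (block x) = x.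
Proof. by apply/funext => i; rewrite /unblock mxE taggedK f'K. Qed.

Lemma block_inj x y : (forall n, block x n = block y n) -> x = y.
Proof.
move=> h; rewrite -(blockK x) -(blockK y); congr unblock.
exact: functional_extensionality_dep.
Qed.

Lemma energy_block x : energy x = (\sum_(n <oo) (fro2 (block x n))%:E)%E.
Proof.
rewrite /energy (nneseries_blocks (f := f)) //; last first.
- by move=> i; rewrite lee_fin cnorm2_ge0.
- by exists f'.
apply: eq_eseriesr => n _; rewrite sumEFin; congr _%:E.
by apply: eq_bigr => b _; rewrite big_ord1 mxE.
Qed.

Definition single n (w : forall n, 'cV[C]_(N n)) : forall n, 'cV[C]_(N n) :=
  fun m => if m == n then w m else 0.

Lemma energy_single n w x : (forall m, block x m = single n w m) ->
  energy x = (fro2 (w n))%:E.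
Proof.
move=> hx; rewrite energy_block (@nneseriesD1 R _ n xpredT) //; last first.
  by move=> k _; rewrite lee_fin fro2_ge0.
rewrite hx /single eqxx eseries0 ?adde0 // => m _ /= /negPf mn.
by rewrite hx /single mn fro20.
Qed.

Variables (G : groupType) (U : forall n, G -> 'M[C]_(N n)).
Hypothesis uU : forall n, urep (U n).

Definition direct_sum (g : G) (x : nat -> C) : nat -> C :=
  unblock (fun n => U n g *m block x n).

Lemma block_direct_sum g x n : block (direct_sum g x) n = U n g *m block x n.
Proof. exact: unblockK. Qed.

Lemma direct_sum_rep : unitary_rep direct_sum.
Proof.
have E g x : energy (direct_sum g x) = energy x.
  rewrite !energy_block; apply: eq_eseriesr => n _; congr _%:E.
  by rewrite block_direct_sum fro2_isoml //; exact: (uU n).1.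
split.
- by move=> g x hx; case: (energy_l2norm hx (E g x)).
- move=> g a x y _ _; apply: block_inj => n; rewrite block_direct_sum.
  have bD u v : block (fun i => a * u i + v i) n = a *: block u n + block v n.
    by apply/matrixP => b j; rewrite !mxE.
  by rewrite !bD !block_direct_sum mulmxDr scalemxAr.
- by move=> g x hx; case: (energy_l2norm hx (E g x)).
- by move=> x _; apply: block_inj => n; rewrite block_direct_sum urep1 // mul1mx.
- move=> g h x _; apply: block_inj => n; rewrite !block_direct_sum.
  by rewrite (uU n).2 mulmxA.
Qed.

End DirectSum.
End Blocks.
End SquareSummable.

(** * Uniform spectral gap from property (T) *)

Section KazhdanPair.
Variables (R : realType) (G : groupType).
Local Notation C := R[i].

Lemma kazhdan_noinv (e : nat -> seq G) (N : nat -> nat)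
    (U : forall n, G -> 'M[C]_(N n)) (x : forall n, 'cV[C]_(N n)) :
  propertyT R G -> (forall m n, (m <= n)%N -> {subset e m <= e n}) ->
  (forall g, exists n, g \in e n) ->
  (forall n, urep (U n)) -> (forall n, fro2 (x n) = 1) ->
  (forall n (v : 'cV[C]_(N n)), (forall g, U n g *m v = v) -> v = 0) ->
  ~ (forall n g, g \in e n -> fro2 (U n g *m x n - x n) < n.+1%:R^-1).
Proof.
move=> T emono ecov uU x1 noinv small.
have N0 n : (0 < N n)%N.
  rewrite lt0n; apply/eqP => Nn; have := x1 n.
  rewrite /fro2 big1 => [/esym/eqP|i _]; first by rewrite oner_eq0.
  by exfalso; case: i => i; rewrite Nn.
have [f [f' fK f'K]] := block_bij N0.
have [xi [_ xi0 xifix]] : exists xi, [/\ l2 xi, xi <> (fun _ => 0) &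
    forall g, direct_sum f f' U g xi = xi].
  apply: T; first exact: direct_sum_rep.
  move=> Q eps eps0.
  have [n0 hn0] : exists n, {subset Q <= e n}.
    elim: Q => [|g Q [n IH]]; first by exists 0%N.
    have [m gm] := ecov g; exists (maxn m n) => h; rewrite inE => /orP[/eqP ->|/IH].
      by apply: emono gm; exact: leq_maxl.
    by apply: emono; exact: leq_maxr.
  have [n1 hn1] : exists n1 : nat, (eps ^+ 2)^-1 < n1.+1%:R.
    exists (Num.trunc (eps ^+ 2)^-1); apply: Num.Theory.truncnS_gt.
  (* From [n0] on [e n] contains [Q]; from [n1] on the squared displacement bound 1/(n+1) is below
     eps^2. *)
  pose n := maxn n0 n1.
  pose xi := unblock f' (single n x).
  have bxi m : block f xi m = single n x m by exact: unblockK.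
  have [l2xi nxi] := l2normE (energy_single fK f'K bxi).
  exists xi; split=> //; first by rewrite nxi x1 sqrtr1.
  move=> g gQ.
  have bd m : block f (fun i => direct_sum f f' U g xi i - xi i) m =
      single n (fun m => U m g *m x m - x m) m.
    transitivity (block f (direct_sum f f' U g xi) m - block f xi m).
      by apply/matrixP => b j; rewrite !mxE.
    rewrite block_direct_sum // bxi /single; case: eqP => // _.
    by rewrite mulmx0 subr0.
  have [_ ->] := l2normE (energy_single fK f'K bd).
  have hs : fro2 (U n g *m x n - x n) < n.+1%:R^-1.
    by apply: small; apply: emono (hn0 _ gQ); exact: leq_maxl.
  rewrite -[ltRHS](ger0_norm (ltW eps0)) -sqrtr_sqr ltr_sqrt ?exprn_gt0 //.
  apply: lt_le_trans hs _; rewrite -[leRHS]invrK lef_pV2 ?posrE ?invr_gt0 ?exprn_gt0 //.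
  apply: le_trans (ltW hn1) _; rewrite ler_nat ltnS; exact: leq_maxr.
(* Each block of an invariant vector is invariant, hence zero by [noinv]. *)
apply: xi0; apply: (block_inj f'K) => n.
have -> : block f (fun _ => 0) n = 0 :> 'cV[C]_(N n) by apply/matrixP => b j; rewrite !mxE.
by apply: noinv => g; rewrite -(block_direct_sum fK) xifix.
Qed.

Theorem kazhdan_pair : countable_group G -> propertyT R G ->
  exists (Q : seq G) (c : R), 0 <= c /\
    forall N (U : G -> 'M[C]_N), urep U -> forall x : 'cV[C]_N,
      exists y, (forall g, U g *m y = y) /\
        fro2 (x - y) <= c * \sum_(g <- Q) fro2 (U g *m x - x).
Proof.
move=> /countable_enum[e [emono ecov]] T; apply: contrapT => H.
have {H} bad n : exists p : {N : nat & ((G -> 'M[C]_N) * 'cV[C]_N)%type},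
    [/\ urep (tagged p).1, fro2 (tagged p).2 = 1,
      forall v : 'cV[C]_(tag p), (forall g, (tagged p).1 g *m v = v) -> v = 0 &
      forall g, g \in e n -> fro2 ((tagged p).1 g *m (tagged p).2 - (tagged p).2) < n.+1%:R^-1].
  (* The candidate pair is [e n] with constant n+1. If [x] violates it, its component without
     invariant part, once normalized, is moved by less than 1/(n+1). *)
  apply: contrapT => nop; apply: H; exists (e n), n.+1%:R; split => // N U uU x.
  have [N' [U' [B' [uU' hB' UB' noinv fixed]]]] := split_invariants uU.
  exists (x - B' *m (B'^h *m x)); split; first exact: fixed.
  rewrite subKr fro2_isoml //; set x' := B'^h *m x.
  have dE g : fro2 (U g *m x - x) = fro2 (U' g *m x' - x').
    rewrite -(fro2_isoml _ hB'); congr fro2.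
    have h : U g *m x - B' *m (U' g *m x') = x - B' *m x'.
      by have := fixed x g; rewrite mulmxBr -/x' (mulmxA (U g)) UB' -mulmxA.
    rewrite mulmxBr -[U g *m x](subrK (B' *m (U' g *m x'))) h.
    by rewrite addrC -addrA addKr addrC.
  rewrite leNgt; apply/negP => lt; apply: nop.
  have sum0 : 0 <= \sum_(g <- e n) fro2 (U g *m x - x) by apply: sumr_ge0 => g _; exact: fro2_ge0.
  have x0 : 0 < fro2 x' by apply: le_lt_trans lt; rewrite mulr_ge0.
  pose s : C := ((Num.sqrt (fro2 x'))^-1)%:C%C.
  have sE : cnorm2 s = (fro2 x')^-1.
    by rewrite /cnorm2 /= expr0n addr0 exprVn sqr_sqrtr ?ltW.
  exists (existT _ N' (U', s *: x')) => /=; split => //.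
    by rewrite fro2Z sE mulVf // gt_eqF.
  move=> g ge; rewrite -scalemxAr -scalerBr fro2Z sE -dE mulrC ltr_pdivrMr //.
  rewrite mulrC ltr_pdivlMr // mulrC; apply: le_lt_trans lt; rewrite ler_pM2l //.
  by rewrite (big_rem g) //= lerDl sumr_ge0 // => g' _; exact: fro2_ge0.
have /choice[p hp] := bad.
apply: (@kazhdan_noinv e (fun n => tag (p n)) (fun n => (tagged (p n)).1)
  (fun n => (tagged (p n)).2) T emono ecov) => n; by have [] := hp n.
Qed.

End KazhdanPair.

(** * Asymptotics and stability *)

Section Negligible.
Variables (R : realType) (k : nat -> nat).
Hypothesis k0 : forall n, (0 < k n)%N.
Local Notation C := R[i].

(** That is, [a n = o(k n)]. For unnormalized squared norms this is convergence to 0 of the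
    normalized norm. *)
Definition negl (a : nat -> R) : Prop := (a n / (k n)%:R) @[n --> \oo] --> (0 : R).

Let kR n : 0 < (k n)%:R :> R. Proof. by rewrite ltr0n. Qed.

Lemma neglP (a : nat -> R) : (forall n, 0 <= a n) ->
  negl a <-> forall eps, 0 < eps -> \forall n \near \oo, a n <= eps * (k n)%:R.
Proof.
move=> a0; split=> [h eps e0|h].
  have /cvgrPdist_le /(_ eps e0) := h; apply: filterS => n.
  by rewrite sub0r normrN ger0_norm ?divr_ge0 // ler_pdivrMr.
apply/cvgrPdist_le => eps e0; have := h eps e0; apply: filterS => n.
by rewrite sub0r normrN ger0_norm ?divr_ge0 // ler_pdivrMr.
Qed.

Lemma negl_le (b a : nat -> R) : (forall n, 0 <= a n) -> (forall n, a n <= b n) ->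
  negl b -> negl a.
Proof.
move=> a0 ab; have b0 n : 0 <= b n by exact: le_trans (ab n).
move=> /(neglP b0) h; apply/(neglP a0) => eps e0; have := h eps e0.
by apply: filterS => n; apply: le_trans.
Qed.

Lemma neglD a b : negl a -> negl b -> negl (fun n => a n + b n).
Proof.
move=> ha hb; rewrite /negl -[X in _ --> X]addr0.
by under eq_fun do rewrite mulrDl; exact: cvgD.
Qed.

Lemma neglZ c a : negl a -> negl (fun n => c * a n).
Proof.
move=> ha; rewrite /negl -[X in _ --> X](mulr0 c).
by under eq_fun do rewrite -mulrA; apply: cvgM => //; exact: cvg_cst.
Qed.

Lemma negl0 : negl (fun _ => 0).
Proof. by rewrite /negl; under eq_fun do rewrite mul0r; exact: cvg_cst. Qed.

Lemma negl_sum (I : Type) (s : seq I) (a : I -> nat -> R) :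
  (forall i, negl (a i)) -> negl (fun n => \sum_(i <- s) a i n).
Proof.
move=> h; elim: s => [|i s IH].
  by under [fun n => _]eq_fun do rewrite big_nil; exact: negl0.
by under [fun n => _]eq_fun do rewrite big_cons; exact: neglD.
Qed.

Lemma negl_hsnorm (x : forall n, 'M[C]_(k n)) :
  (hsnorm (x n) @[n --> \oo] --> (0 : R)) <-> negl (fun n => fro2 (x n)).
Proof.
have p n : 0 <= fro2 (x n) / (k n)%:R by rewrite divr_ge0 ?fro2_ge0.
split=> h.
  rewrite /negl (_ : (fun n => _) = (fun n => hsnorm (x n) * hsnorm (x n))).
    by rewrite -[X in _ --> X](mulr0 0); exact: cvgM.
  by apply/funext => n; rewrite hsnormE -expr2 sqr_sqrtr.
rewrite (_ : (fun n => _) = Num.sqrt \o (fun n => fro2 (x n) / (k n)%:R)).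
  have := @sqrt_continuous R 0; rewrite /continuous_at sqrtr0 => c.
  exact: (cvg_comp _ _ h c).
by apply/funext => n; rewrite /= hsnormE.
Qed.

Lemma negl_ratio (m : nat -> nat) : (forall n, (k n <= m n)%N) ->
  ((m n)%:R / (k n)%:R @[n --> \oo] --> (1 : R)) <->
  negl (fun n => (m n)%:R - (k n)%:R).
Proof.
move=> km; have E : (fun n => (m n)%:R / (k n)%:R : R) =
    (fun n => ((m n)%:R - (k n)%:R) / (k n)%:R + 1).
  by apply/funext => n; rewrite mulrBl divff ?subrK // gt_eqF.
rewrite /negl E; split=> h; last first.
  by rewrite -[X in _ --> X]add0r; apply: cvgD => //; exact: cvg_cst.
rewrite -[X in _ --> X](subrr 1).
rewrite (_ : (fun n => _) = (fun n => ((m n)%:R - (k n)%:R) / (k n)%:R + 1 - 1 : R)).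
  by apply: cvgB => //; exact: cvg_cst.
by apply/funext => n; rewrite addrK.
Qed.

End Negligible.

Section Stability.
Variables (R : realType) (b : bool).
Local Notation C := R[i].

(* Both notions of stability at once: [b] forbids enlarging the dimension, and the
   isometry [J] replaces the standard inclusion of C^k into C^m. *)
Definition gen_stable (Gm : groupType) : Prop :=
  forall (k : nat -> nat) (phi : forall n, Gm -> 'M[C]_(k n)),
    (forall n, (0 < k n)%N) -> (forall n g, isom (phi n g)) ->
    (forall g h, negl k (fun n => fro2 (phi n (g * h)%g - phi n g *m phi n h))) ->
    exists (m : nat -> nat) (J : forall n, 'M[C]_(m n, k n)) (pi : forall n, Gm -> 'M[C]_(m n)),
      [/\ b -> forall n, m n = k n, forall n, urep (pi n), forall n, isom (J n),
          negl k (fun n => (m n)%:R - (k n)%:R : R) &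
          forall g, negl k (fun n => fro2 (phi n g - (J n)^h *m pi n g *m J n))].

Lemma fro2_isomB k (u v : 'M[C]_k) : isom u -> isom v -> fro2 (u - v) <= 4 * k%:R.
Proof. by move=> hu hv; apply: le_trans (fro2B_le _ _) _; rewrite !fro2_isom //; lra. Qed.

Lemma defect_ge0 (H : groupType) F' d (chi : H -> 'M[C]_d) : 0 <= defect F' chi.
Proof. by apply: sumr_ge0 => p _; exact: fro2_ge0. Qed.

Lemma cost_triv (H : groupType) (F : seq H) d (chi : H -> 'M[C]_d) :
  (forall h, isom (chi h)) ->
  cost F chi (fun _ => 1%:M) 1%:M <= 4 * (size F)%:R * d%:R.
Proof.
move=> hchi; rewrite /cost subrr addr0 mulrAC; elim: F => [|h F IH].
  by rewrite big_nil mulr0.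
rewrite big_cons /= -[(size F).+1%:R]natr1 mulrDr mulr1 addrC; apply: lerD => //.
by rewrite adj1 mul1mx mulmx1; apply: fro2_isomB => //; exact: isom1.
Qed.

(** Take counterexamples with K = j+1 and [F' j] exhausting pairs in [H]. Comparison with the
    trivial representation bounds their defect by a multiple of d/(j+1), so they form an asymptotic
    homomorphism. Stability then makes the cost o(d), against cost > eps d. *)
Theorem stable_correctable (H : groupType) : countable_group H -> gen_stable H ->
  forall (F : seq H) (eps : R), 0 < eps ->
    exists F' (K : R), 0 <= K /\ correctable b F F' eps K.
Proof.
move=> /countable_enum[e [emono ecov]] st F eps eps0; apply: contrapT => nex.
pose F' j := [seq (x, y) | x <- e j, y <- e j].
have {nex} bad j : exists p : {d : nat & H -> 'M[C]_d},
    (forall h, isom (tagged p h)) /\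
    forall d' (chi' : H -> 'M[C]_d') (J : 'M[C]_(d', tag p)),
      urep chi' -> isom J -> (b -> d' = tag p) ->
      eps * (tag p)%:R + j.+1%:R * defect (F' j) (tagged p) < cost F (tagged p) chi' J.
  apply: contrapT => nop; apply: nex; exists (F' j), j.+1%:R; split => // d chi hchi.
  apply: contrapT => nod; apply: nop; exists (existT _ d chi) => /=; split => //.
  move=> d' chi' J u i e'; rewrite ltNge; apply/negP => le; apply: nod.
  by exists d', chi', J.
have /choice[p hp] := bad.
pose d j := tag (p j); pose chi j := tagged (p j) : H -> 'M[C]_(d j).
have ichi j h : isom (chi j h) by case: (hp j) => i _; exact: i.
have big j d' (chi' : H -> 'M[C]_d') (J : 'M[C]_(d', d j)) :
    urep chi' -> isom J -> (b -> d' = d j) ->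
    eps * (d j)%:R + j.+1%:R * defect (F' j) (chi j) < cost F (chi j) chi' J.
  by case: (hp j) => _ h; exact: h.
have triv j : eps * (d j)%:R + j.+1%:R * defect (F' j) (chi j) < 4 * (size F)%:R * (d j)%:R.
  apply: lt_le_trans (big j _ _ _ (urep_triv _ _ (d j)) (isom1 _ _) (fun _ => erefl)) _.
  exact: cost_triv.
(* In dimension 0 the estimate [triv] would make a nonnegative multiple of the defect negative. *)
have d0 j : (0 < d j)%N.
  rewrite lt0n; apply/eqP => dj; have dR : (d j)%:R = 0 :> R by rewrite dj.
  have := triv j; rewrite dR !mulr0 add0r => h.
  by move: h; rewrite ltNge mulr_ge0 ?defect_ge0.
have as_ g h : negl d (fun j => fro2 (chi j (g * h)%g - chi j g *m chi j h)).
  apply/(neglP d0) => [n|eta eta0]; first exact: fro2_ge0.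
  have [j1 gj] := ecov g; have [j2 hj] := ecov h.
  pose j3 := Num.trunc (4 * (size F)%:R / eta).
  exists (maxn j1 (maxn j2 j3)) => // j /=; rewrite !geq_max => /and3P[j1j j2j j3j].
  have inF : (g, h) \in F' j.
    by apply: allpairs_f; [exact: emono gj | exact: emono hj].
  have le1 : fro2 (chi j (g * h)%g - chi j g *m chi j h) <= defect (F' j) (chi j).
    by rewrite /defect (big_rem _ inF) /= lerDl; apply: sumr_ge0 => q _; exact: fro2_ge0.
  have le2 : j.+1%:R * defect (F' j) (chi j) <= 4 * (size F)%:R * (d j)%:R.
    by apply: ltW; apply: le_lt_trans (triv j); rewrite lerDr mulr_ge0 // ltW.
  have le3 : 4 * (size F)%:R <= eta * j.+1%:R.
    rewrite [leRHS]mulrC -ler_pdivrMr //.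
    have lt4 : 4 * (size F)%:R / eta < j3.+1%:R by exact: truncnS_gt.
    by apply: le_trans (ltW lt4) _; rewrite ler_nat ltnS.
  apply: le_trans le1 _; rewrite -(ler_pM2l (_ : 0 < j.+1%:R :> R)) //.
  apply: le_trans le2 _; rewrite mulrA [_ * eta]mulrC.
  by apply: ler_wpM2r le3.
have [m [J [pi [bm upi iJ mk close]]]] := st d chi d0 ichi as_.
have neg : negl d (fun j => cost F (chi j) (pi j) (J j)).
  by apply: neglD => //; apply: negl_sum => h; exact: close.
have cost0 j : 0 <= cost F (chi j) (pi j) (J j).
  apply: addr_ge0; first by apply: sumr_ge0 => h _; exact: fro2_ge0.
  by rewrite subr_ge0 ler_nat; exact: isom_leq (iJ j).
have /(neglP d0 cost0) /(_ eps eps0) [j _ /(_ j (leqnn j)) /=] := neg.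
have := big j _ _ _ (upi j) (iJ j) (fun hb => bm hb j).
have := mulr_ge0 (ler0n R j.+1) (defect_ge0 (F' j) (chi j)).
lra.
Qed.

End Stability.

(** For each n the object is built for the largest [j <= n] with [P n j], and monotonicity of [Q]
    serves all smaller levels. The first hypothesis supplies a default when no level is
    available. *)
Lemma diagonal (T : nat -> Type) (V : forall n, T n -> Prop) (P : nat -> nat -> Prop)
    (Q : forall n, nat -> T n -> Prop) :
  (forall n, exists X, V n X) ->
  (forall n j, P n j -> exists X, V n X /\ Q n j X) ->
  (forall n i j X, (i <= j)%N -> Q n j X -> Q n i X) ->
  (forall j, \forall n \near \oo, P n j) ->
  exists X : forall n, T n, (forall n, V n (X n)) /\
    forall j, \forall n \near \oo, Q n j (X n).
Proof.
move=> V0 PQ Qmono Pev.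
have best n : exists X, V n X /\ forall j, (j <= n)%N -> P n j -> Q n j X.
  have [[j0 [j0n hj0]]|no] := pselect (exists j, (j <= n)%N /\ P n j); last first.
    have [X VX] := V0 n; exists X; split => // j jn hj; exfalso; apply: no.
    by exists j.
  pose p j := (j <= n)%N && `[< P n j >].
  have ex : exists j, p j by exists j0; rewrite /p j0n; apply/asboolP.
  have pb j : p j -> (j <= n)%N by case/andP.
  have [j /andP[jn /asboolP hj] jmax] := ex_maxnP ex pb.
  have [X [VX QX]] := PQ n j hj; exists X; split => // i iN hi.
  by apply: Qmono QX; apply: jmax; rewrite /p iN; apply/asboolP.
exists (fun n => projT1 (cid (best n))); split=> [n|j].
  by have [] := projT2 (cid (best n)).
have := Pev j; have : \forall n \near \oo, (j <= n)%N by exact: nbhs_infty_ge.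
by apply: filterS2 => n jn Pn; have [_] := projT2 (cid (best n)); apply.
Qed.

(** * Products *)

Section Dilation.
Variable R : realType.
Local Notation C := R[i].
Variables (m k : nat) (J : 'M[C]_(m, k)).
Hypothesis hJ : isom J.

(** [u] on the range of [J], the identity on its complement; extension by zero would lose
    unitarity. *)
Definition dilate (u : 'M[C]_k) : 'M[C]_m := J *m u *m J^h + (1%:M - J *m J^h).

Let Q : 'M[C]_m := 1%:M - J *m J^h.
Let QJ : Q *m J = 0. Proof. by rewrite mulmxBl mul1mx -mulmxA hJ mulmx1 subrr. Qed.
Let Qh : Q^h = Q. Proof. by rewrite adjB adj1 adjM adjK. Qed.
Let JQ : J^h *m Q = 0. Proof. by rewrite -[LHS]adjK adjM adjK Qh QJ adj0. Qed.
Let QQ : Q *m Q = Q.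
Proof. by rewrite {2}/Q mulmxBr mulmx1 mulmxA QJ mul0mx subr0. Qed.

Lemma dilateM u v : dilate u *m dilate v = dilate (u *m v).
Proof.
move: QQ QJ JQ; rewrite /dilate -/Q; move: Q => q qq qJ Jq.
rewrite mulmxDl !mulmxDr qq !mulmxA qJ !mul0mx add0r.
rewrite -(mulmxA (J *m u) J^h q) Jq mulmx0 addr0 -(mulmxA (J *m u) J^h J) hJ mulmx1.
by rewrite -!mulmxA.
Qed.

Lemma dilate1 : dilate 1%:M = 1%:M.
Proof. by rewrite /dilate mulmx1 addrC subrK. Qed.

Lemma adj_dilate u : (dilate u)^h = dilate u^h.
Proof. by rewrite /dilate -/Q adjD Qh !adjM adjK mulmxA. Qed.

Lemma isom_dilate u : isom u -> isom (dilate u).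
Proof. by move=> hu; rewrite /isom adj_dilate dilateM hu dilate1. Qed.

Lemma fro2_dilateB u v : fro2 (dilate u - dilate v) = fro2 (u - v).
Proof.
rewrite /dilate opprD addrACA subrr addr0 -mulmxBl -mulmxBr.
by rewrite fro2_isomr // fro2_isoml.
Qed.

Lemma dilateK u : J^h *m dilate u *m J = u.
Proof.
move: JQ; rewrite /dilate -/Q; move: Q => q Jq.
rewrite mulmxDr mulmxDl Jq mul0mx addr0 !mulmxA hJ mul1mx.
by rewrite -mulmxA hJ mulmx1.
Qed.

(** Both matrices are unitary, so only their inner product matters. Its part on the range of [J] is
    at least k minus a Cauchy-Schwarz error, its part on the complement at least -(m - k). No
    control of the off-diagonal corners of [pi] is required; the price is an error linear, not
    quadratic, in [hsnorm]. *)
Lemma dilate_close u pi : (0 < k)%N -> isom u -> isom pi ->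
  fro2 (pi - dilate u) <=
  4 * (m%:R - k%:R) + 2 * (hsnorm (u - J^h *m pi *m J) * k%:R).
Proof.
move=> k0 hu hpi; have hd := isom_dilate hu.
have fQ : fro2 Q = m%:R - k%:R.
  rewrite fro2B (fro2_isom (isom1 _ _)) fro2_isomr // fro2_isom //.
  by rewrite dotC dotMr mul1mx adjK -fro2E fro2_isom //; ring.
rewrite fro2B !fro2_isom // dotC /dilate -/Q dotDl.
have -> : dot (J *m u *m J^h) pi = dot u (J^h *m pi *m J).
  by rewrite -mulmxA dotMl dotMr adjK.
have q1 : - fro2 Q <= dot Q pi.
  rewrite -{2}QQ dotMl Qh; have := fro2_ge0 (Q + Q *m pi).
  rewrite fro2D fro2_unitr //; lra.
have q2 : k%:R - hsnorm (u - J^h *m pi *m J) * k%:R <= dot u (J^h *m pi *m J).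
  have := cauchy_schwarz u (u - J^h *m pi *m J).
  rewrite dotDr dotNr -fro2E fro2_isom //.
  suff -> : Num.sqrt k%:R * Num.sqrt (fro2 (u - J^h *m pi *m J)) =
      hsnorm (u - J^h *m pi *m J) * k%:R by lra.
  have kR : 0 < k%:R :> R by rewrite ltr0n.
  rewrite hsnormE -{3}[k%:R]ger0_norm // -sqrtr_sqr -!sqrtrM ?divr_ge0 ?fro2_ge0 //.
  by congr Num.sqrt; rewrite expr2 mulrA divfK ?gt_eqF // mulrC.
rewrite fQ in q1; lra.
Qed.

End Dilation.

(** * The conjugation representation and distance to the commutant *)

Section Conjugation.
Variables (R : realType) (G : groupType).
Local Notation C := R[i].

(** The entrywise conjugate: [A *t conjmat A] acts on vectorized matrices by X -> A X A^h. *)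
Definition conjmat m n (A : 'M[C]_(m, n)) : 'M[C]_(m, n) := A^h^T.

Lemma isom_conjmat n (A : 'M[C]_n) : isom A -> isom (conjmat A).
Proof.
move=> hA; rewrite /isom /conjmat.
have -> : (A^h^T)^h = A^T by apply/matrixP => i j; rewrite adjE !mxE ?adjE conjcK.
by rewrite -trmx_mul hA trmx1.
Qed.

Definition vecmat m (X : 'M[C]_m) : 'cV[C]_(m * m) :=
  \col_p X (mxtens_unindex p).1 (mxtens_unindex p).2.

Definition unvecmat m (v : 'cV[C]_(m * m)) : 'M[C]_m :=
  \matrix_(i, j) v (mxtens_index (i, j)) 0.

Lemma vecmatK m : cancel (@vecmat m) (@unvecmat m).
Proof. by move=> X; apply/matrixP => i j; rewrite !mxE mxtens_indexK. Qed.

Lemma unvecmatK m : cancel (@unvecmat m) (@vecmat m).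
Proof.
by move=> v; apply/matrixP => p j; rewrite !mxE ord1 -surjective_pairing mxtens_unindexK.
Qed.

Lemma vecmatB m (X Y : 'M[C]_m) : vecmat (X - Y) = vecmat X - vecmat Y.
Proof. by apply/matrixP => p j; rewrite !mxE. Qed.

Lemma fro2_vecmat m (X : 'M[C]_m) : fro2 (vecmat X) = fro2 X.
Proof.
rewrite /fro2 sum_tens; apply: eq_bigr => i _; apply: eq_bigr => j _.
by rewrite big_ord1 mxE mxtens_indexK.
Qed.

Lemma tens_vecmat m (A B X : 'M[C]_m) : (A *t B) *m vecmat X = vecmat (A *m X *m B^T).
Proof.
apply/matrixP => p q; case: (mxtens_indexP p) => i j; rewrite ord1 {p q}.
rewrite [RHS]mxE mxtens_indexK !mxE sum_tens /= exchange_big /=; apply: eq_bigr => b _.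
rewrite !mxE mulr_suml; apply: eq_bigr => a _.
by rewrite tensmxE mxE mxtens_indexK /= mulrAC.
Qed.

Lemma conj_urep m (pi : G -> 'M[C]_m) : urep pi -> urep (fun g => pi g *t conjmat (pi g)).
Proof.
move=> [iso mul]; split=> [g|g h].
  by apply: isom_tens => //; exact: isom_conjmat.
by rewrite tensmx_mul mul /conjmat adjM trmx_mul.
Qed.

(** The fixed vectors of conjugation form the commutant, and the displacement of [X] has the norm of
    the commutator because multiplication by the unitary [pi g] preserves [fro2]. *)
Lemma commutant_near : countable_group G -> propertyT R G ->
  exists (Q : seq G) (c : R), 0 <= c /\
    forall m (pi : G -> 'M[C]_m), urep pi -> forall X : 'M[C]_m,
      exists Y, (forall g, pi g *m Y = Y *m pi g) /\
        fro2 (X - Y) <= c * \sum_(g <- Q) fro2 (pi g *m X - X *m pi g).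
Proof.
move=> cG T; have [Q [c [c0 hc]]] := kazhdan_pair cG T.
exists Q, c; split => // m pi upi X.
have [y [yinv yc]] := hc _ _ (conj_urep upi) (vecmat X).
have act g (Z : 'M[C]_m) :
    (pi g *t conjmat (pi g)) *m vecmat Z = vecmat (pi g *m Z *m (pi g)^h).
  by rewrite tens_vecmat trmxK.
exists (unvecmat y); split=> [g|].
  have := yinv g; rewrite -[y in LHS]unvecmatK act => /(congr1 (@unvecmat m)).
  rewrite vecmatK => e; rewrite -{2}e -(mulmxA _ (pi g)^h) (upi.1 g : (pi g)^h *m pi g = _).
  by rewrite mulmx1.
rewrite -fro2_vecmat vecmatB unvecmatK; apply: le_trans yc _.
rewrite le_eqVlt; apply/orP; left; apply/eqP; congr (_ * _); apply: eq_bigr => g _.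
rewrite act -vecmatB fro2_vecmat -(fro2_unitr _ (upi.1 g)) mulmxBl.
by rewrite -(mulmxA _ (pi g)^h) (upi.1 g : (pi g)^h *m pi g = _) mulmx1.
Qed.

(** The commutant is closed under [^h], as [(pi g)^h = pi g^-1], so [polar_near] stays inside it;
    this is the origin of the factor 16. *)
Lemma unitary_commutant_near : countable_group G -> propertyT R G ->
  exists (Q : seq G) (c : R), 0 <= c /\
    forall m (pi : G -> 'M[C]_m), urep pi -> forall X : 'M[C]_m, isom X ->
      exists w, [/\ isom w, forall g, pi g *m w = w *m pi g &
        fro2 (w - X) <= c * \sum_(g <- Q) fro2 (pi g *m X - X *m pi g)].
Proof.
move=> cG T; have [Q [c [c0 hc]]] := commutant_near cG T.
exists Q, (16 * c); split; first exact: mulr_ge0.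
move=> m pi upi X hX; have [Y [Yc Yn]] := hc m pi upi X.
have [w [hw wn wc]] := polar_near Y hX.
exists w; split => //; last first.
  by apply: le_trans wn _; rewrite -mulrA ler_pM2l // fro2BC.
move=> g; apply: wc => //; rewrite -[pi g]adjK -!adjM -urepV //.
by rewrite Yc.
Qed.

End Conjugation.

Lemma le_chain2 (R : realDomainType) (a b c d e f : R) :
  d <= 2 * b + 2 * c -> e <= 4 * a -> f <= 2 * e + 2 * d ->
  f <= 8 * a + (4 * b + 4 * c).
Proof. lra. Qed.

Lemma le_chain3 (R : realDomainType) (x y z a b c d : R) :
  x <= 2 * a + 2 * y -> y <= 2 * b + 2 * z -> z <= 2 * c + 2 * d ->
  x <= 2 * a + (4 * b + (8 * c + 8 * d)).
Proof. lra. Qed.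

Lemma add22 (R : realDomainType) (a : R) : 2 * a + 2 * a <= 4 * a.
Proof. lra. Qed.

Lemma commutator_split (S : pzRingType) n (p q s : 'M[S]_n) :
  p *m s - s *m p = ((p - q) *m s - s *m (p - q)) + (q *m s - s *m q).
Proof.
rewrite mulmxBl mulmxBr opprB.
move: (p *m s) (q *m s) (s *m p) (s *m q) => x y z t.
by rewrite addrACA subrK (addrAC t) subrr add0r.
Qed.

(** * Correcting both factors simultaneously *)

Section Product.
Variables (R : realType) (b : bool) (G H : groupType).
Local Notation C := R[i].
Local Notation GH := (prod_group G H).

Definition inlg (g : G) : GH := (g, 1%g).
Definition inrg (h : H) : GH := (1%g, h).

Lemma inlgM g g' : inlg (g * g')%g = (inlg g * inlg g')%g.
Proof. by congr pair; rewrite mulg1. Qed.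
Lemma inrgM h h' : inrg (h * h')%g = (inrg h * inrg h')%g.
Proof. by congr pair; rewrite mulg1. Qed.
Lemma inlr g h : (inlg g * inrg h)%g = (g, h).
Proof. by congr pair; rewrite /= ?mulg1 ?mul1g. Qed.
Lemma inrl g h : (inrg h * inlg g)%g = (g, h).
Proof. by congr pair; rewrite /= ?mulg1 ?mul1g. Qed.

(** [amplification] is applied at each n, with precision [eps j] chosen by [diagonal]. The
    intertwining relation for [J] ensures that correcting [H] does not undo the correction of
    [G]. *)
Lemma correct_commuting (k m : nat -> nat) (pi : forall n, G -> 'M[C]_(m n))
    (psi : forall n, H -> 'M[C]_(m n)) :
  countable_group H -> gen_stable R b H -> (forall n, (0 < k n)%N) ->
  (forall n, (k n <= m n)%N) -> negl k (fun n => (m n)%:R - (k n)%:R : R) ->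
  (forall n, urep (pi n)) -> (forall n h, isom (psi n h)) ->
  (forall n g h, pi n g *m psi n h = psi n h *m pi n g) ->
  (forall h h', negl k (fun n => fro2 (psi n (h * h')%g - psi n h *m psi n h'))) ->
  exists (M : nat -> nat) (J : forall n, 'M[C]_(M n, m n))
      (pi' : forall n, G -> 'M[C]_(M n)) (rho : forall n, H -> 'M[C]_(M n)),
    (forall n, [/\ urep (pi' n) /\ urep (rho n),
       forall g h, pi' n g *m rho n h = rho n h *m pi' n g,
       isom (J n) /\ (b -> M n = m n) &
       forall g, pi' n g *m J n = J n *m pi n g]) /\
    negl k (fun n => (M n)%:R - (m n)%:R : R) /\
    forall h, negl k (fun n => fro2 (psi n h - (J n)^h *m rho n h *m J n)).
Proof.
move=> cH sH k0 km mk upi ipsi com defect0.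
have [e [emono ecov]] := countable_enum cH.
pose eps j : R := j.+1%:R^-1.
have eps0 j : 0 < eps j by rewrite invr_gt0.
have corr j : exists q : (seq (H * H) * R)%type,
    0 <= q.2 /\ correctable b (e j) q.1 (eps j) q.2.
  have [F' [K [K0 hK]]] := stable_correctable cH sH (e j) (eps0 j).
  by exists (F', K).
have /choice[q hq] := corr.
pose T n := {M : nat & ((G -> 'M[C]_M) * (H -> 'M[C]_M) * 'M[C]_(M, m n))%type}.
pose V n (X : T n) := [/\ urep (tagged X).1.1 /\ urep (tagged X).1.2,
  forall g h, (tagged X).1.1 g *m (tagged X).1.2 h = (tagged X).1.2 h *m (tagged X).1.1 g,
  isom (tagged X).2 /\ (b -> tag X = m n) &
  forall g, (tagged X).1.1 g *m (tagged X).2 = (tagged X).2 *m pi n g].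
(* The first clause means m <= 2k. The estimate eps m + K defect is then at most 2 eps k + eps k,
   whence the 3 in [Q]. *)
pose P n j := (m n)%:R - (k n)%:R <= 1 * (k n)%:R :> R /\
  (q j).2 * defect (q j).1 (psi n) <= eps j * (k n)%:R :> R.
pose Q n j (X : T n) := (tag X)%:R - (m n)%:R <= 3 * eps j * (k n)%:R /\
  forall h, h \in e j ->
    fro2 (psi n h - (tagged X).2^h *m (tagged X).1.2 h *m (tagged X).2) <=
    3 * eps j * (k n)%:R.
have [||| |X [VX QX]] := @diagonal T V P Q.
(* Default object: [pi n] itself with the trivial representation of [H]. *)
- move=> n; exists (existT _ (m n) (pi n, fun _ => 1%:M, 1%:M)); split => /=.
  + by split => //; exact: urep_triv.
  + by move=> g h; rewrite mulmx1 mul1mx.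
  + by split => //; exact: isom1.
  + by move=> g; rewrite mulmx1 mul1mx.
- move=> n j [P1 P2]; have [q0 qc] := hq j.
  have [M [pi' [rho [J [u1 u2 u3 u4 u5]]]]] :=
    amplification qc (upi n) (ipsi n) (com n).
  exists (existT _ M (pi', rho, J)); split => //=.
  have bound : cost (e j) (psi n) rho J <= 3 * eps j * (k n)%:R.
    apply: le_trans u5 _; have := eps0 j; move: P1 P2.
    move: (eps j) (_ * defect _ _) ((m n)%:R) ((k n)%:R) => x y mm kk; nra.
  have dim0 : 0 <= M%:R - (m n)%:R :> R.
    by rewrite subr_ge0 ler_nat; exact: isom_leq u3.1.
  have sum0 (s : seq H) : 0 <= \sum_(h <- s) fro2 (psi n h - J^h *m rho h *m J).
    by apply: sumr_ge0 => h _; exact: fro2_ge0.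
  split; first by apply: le_trans bound; rewrite /cost lerDr.
  move=> h hj; apply: le_trans bound; rewrite /cost (big_rem h hj) /= -addrA lerDl.
  exact: addr_ge0.
- move=> n i j X ij [Q1 Q2].
  have le : 3 * eps j * (k n)%:R <= 3 * eps i * (k n)%:R.
    by rewrite ler_wpM2r // ler_pM2l // lef_pV2 ?posrE // ler_nat ltnS.
  split; first exact: le_trans le.
  by move=> h hi; apply: le_trans le; apply: Q2; exact: emono hi.
- move=> j; have [q0 _] := hq j.
  have d0 : negl k (fun n => (q j).2 * defect (q j).1 (psi n)).
    apply: neglZ; apply: (@negl_sum _ k _ _ (fun p n =>
      fro2 (psi n (p.1 * p.2)%g - psi n p.1 *m psi n p.2))) => p; exact: defect0.
  have m0 n : 0 <= (m n)%:R - (k n)%:R :> R by rewrite subr_ge0 ler_nat.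
  have := (neglP k0 m0).1 mk 1 ltr01.
  have dq0 n : 0 <= (q j).2 * defect (q j).1 (psi n).
    by apply: mulr_ge0 => //; exact: defect_ge0.
  have := (neglP k0 dq0).1 d0 (eps j) (eps0 j).
  by apply: filterS2 => n ? ?.
exists (fun n => tag (X n)), (fun n => (tagged (X n)).2),
  (fun n => (tagged (X n)).1.1), (fun n => (tagged (X n)).1.2); split; first exact: VX.
have small (a : nat -> R) j0 : (forall n, 0 <= a n) ->
    (forall j n, (j0 <= j)%N -> Q n j (X n) -> a n <= 3 * eps j * (k n)%:R) -> negl k a.
  move=> a0 h; apply/(neglP k0 a0) => d dp.
  pose j := maxn j0 (Num.trunc (3 / d)).
  have := QX j; apply: filterS => n /(h j n (leq_maxl _ _)) => le.
  apply: le_trans le _; rewrite ler_wpM2r // /eps ler_pdivrMr // mulrC -ler_pdivrMr //.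
  have lt3 : 3 / d < (Num.trunc (3 / d)).+1%:R by exact: truncnS_gt.
  by apply: le_trans (ltW lt3) _; rewrite ler_nat ltnS leq_maxr.
split.
  apply: (small _ 0%N) => [n|j n _ [] //].
  by rewrite subr_ge0 ler_nat; have [_ _ [iJ _] _] := VX n; exact: isom_leq iJ.
move=> h; have [j0 hj0] := ecov h; apply: (small _ j0) => [n|j n jj [_ hQ]].
  exact: fro2_ge0.
by apply: hQ; exact: emono hj0.
Qed.

Theorem gen_stable_prod : countable_group G -> countable_group H -> propertyT R G ->
  gen_stable R b G -> gen_stable R b H -> gen_stable R b GH.
Proof.
move=> cG cH T sG sH k phi k0 iphi aphi.
have [m [J [pi [bm upi iJ mk close]]]] := sG k (fun n g => phi n (inlg g)) k0
  (fun n g => iphi n _) (fun g g' => eq_ind _ (fun x => negl k (fun n =>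
     fro2 (phi n x - phi n (inlg g) *m phi n (inlg g')))) (aphi _ _) _ (esym (inlgM g g'))).
have km n : (k n <= m n)%N := isom_leq (iJ n).
pose Phi n g := dilate (J n) (phi n (inlg g)).
pose Psi n h := dilate (J n) (phi n (inrg h)).
have iPhi n g : isom (Phi n g) by apply: isom_dilate.
have iPsi n h : isom (Psi n h) by apply: isom_dilate.
have S1 g : negl k (fun n => fro2 (pi n g - Phi n g)).
  apply: (negl_le k0 _ (fun n => dilate_close (iJ n) (k0 n) (iphi n _) ((upi n).1 g))).
    by move=> n; exact: fro2_ge0.
  apply: neglD; first exact: neglZ.
  apply: neglZ; rewrite /negl.
  have /(negl_hsnorm (fun n => _ - _)) hs := close g.
  rewrite (_ : (fun n => _) =
    (fun n => hsnorm (phi n (inlg g) - (J n)^h *m pi n g *m J n))) //.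
  by apply/funext => n; rewrite mulfK // pnatr_eq0 -lt0n.
have PhiPsiB n g h : fro2 (Phi n g *m Psi n h - Psi n h *m Phi n g) =
    fro2 (phi n (inlg g) *m phi n (inrg h) - phi n (inrg h) *m phi n (inlg g)).
  by rewrite (dilateM (iJ n)) (dilateM (iJ n)) (fro2_dilateB (iJ n)).
have PsiB n h h' : fro2 (Psi n (h * h')%g - Psi n h *m Psi n h') =
    fro2 (phi n (inrg h * inrg h')%g - phi n (inrg h) *m phi n (inrg h')).
  by rewrite (dilateM (iJ n)) (fro2_dilateB (iJ n)) inrgM.
have PhiPsiK n g h : phi n (inlg g) *m phi n (inrg h) =
    (J n)^h *m (Phi n g *m Psi n h) *m J n.
  by rewrite (dilateM (iJ n)) dilateK.
clearbody Phi Psi.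
(* Almost commutation comes from [(g, h)] being both [inlg g * inrg h] and [inrg h * inlg g];
   replacing [Phi] by [pi] costs [S1]. *)
have S2 g h : negl k (fun n => fro2 (pi n g *m Psi n h - Psi n h *m pi n g)).
  apply: (@negl_le _ k k0 (fun n => 8 * fro2 (pi n g - Phi n g) +
    (4 * fro2 (phi n (inlg g * inrg h)%g - phi n (inlg g) *m phi n (inrg h)) +
     4 * fro2 (phi n (inrg h * inlg g)%g - phi n (inrg h) *m phi n (inlg g))))).
  - by move=> n; exact: fro2_ge0.
  - move=> n; rewrite inlr inrl.
    have h2 := fro2_tri (phi n (g, h)) (phi n (inlg g) *m phi n (inrg h))
      (phi n (inrg h) *m phi n (inlg g)).
    have h3 : fro2 ((pi n g - Phi n g) *m Psi n h - Psi n h *m (pi n g - Phi n g)) <=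
        4 * fro2 (pi n g - Phi n g).
      apply: le_trans (fro2B_le _ _) _.
      by rewrite fro2_unitr // fro2_isoml // add22.
    have h4 : pi n g *m Psi n h - Psi n h *m pi n g =
        ((pi n g - Phi n g) *m Psi n h - Psi n h *m (pi n g - Phi n g)) +
        (Phi n g *m Psi n h - Psi n h *m Phi n g).
      exact: commutator_split.
    have := fro2D_le ((pi n g - Phi n g) *m Psi n h - Psi n h *m (pi n g - Phi n g))
      (Phi n g *m Psi n h - Psi n h *m Phi n g).
    rewrite -h4 PhiPsiB; rewrite (fro2BC _ (phi n (g, h))) in h2; exact: le_chain2 h2 h3.
  - by apply: neglD; [exact: neglZ | apply: neglD; apply: neglZ; exact: aphi].
have [Q [c [c0 near]]] := unitary_commutant_near cG T.
have [psi psiP] : exists psi : forall n, H -> 'M[C]_(m n), forall n h,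
    [/\ isom (psi n h), forall g, pi n g *m psi n h = psi n h *m pi n g &
      fro2 (psi n h - Psi n h) <=
      c * \sum_(g <- Q) fro2 (pi n g *m Psi n h - Psi n h *m pi n g)].
  exists (fun n h => projT1 (cid (near _ _ (upi n) _ (iPsi n h)))) => n h.
  exact: (projT2 (cid (near _ _ (upi n) _ (iPsi n h)))).
have ipsi n h : isom (psi n h) by have [] := psiP n h.
have S3 h : negl k (fun n => fro2 (psi n h - Psi n h)).
  apply: (@negl_le _ k k0 (fun n =>
    c * \sum_(g <- Q) fro2 (pi n g *m Psi n h - Psi n h *m pi n g))).
  - by move=> n; exact: fro2_ge0.
  - by move=> n; have [] := psiP n h.
  apply: neglZ; apply: (@negl_sum _ k _ _ (fun g n =>
    fro2 (pi n g *m Psi n h - Psi n h *m pi n g))) => g; exact: S2.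
have S4 h h' : negl k (fun n => fro2 (psi n (h * h')%g - psi n h *m psi n h')).
  apply: (@negl_le _ k k0 (fun n => 2 * fro2 (psi n (h * h')%g - Psi n (h * h')%g) +
    (4 * fro2 (phi n (inrg h * inrg h')%g - phi n (inrg h) *m phi n (inrg h')) +
     (8 * fro2 (psi n h - Psi n h) + 8 * fro2 (psi n h' - Psi n h'))))).
  - by move=> n; exact: fro2_ge0.
  - move=> n; have t1 := fro2_tri (Psi n (h * h')%g) (psi n (h * h')%g) (psi n h *m psi n h').
    have t2 := fro2_tri (Psi n h *m Psi n h') (Psi n (h * h')%g) (psi n h *m psi n h').
    have t3 := fro2_tri (psi n h *m Psi n h') (Psi n h *m Psi n h') (psi n h *m psi n h').
    have e2 : fro2 (Psi n h *m Psi n h' - psi n h *m Psi n h') = fro2 (psi n h - Psi n h).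
      by rewrite -mulmxBl fro2_unitr // fro2BC.
    have e3 : fro2 (psi n h *m Psi n h' - psi n h *m psi n h') = fro2 (psi n h' - Psi n h').
      by rewrite -mulmxBr fro2_isoml // fro2BC.
    rewrite PsiB in t2; rewrite e2 e3 in t3; exact: le_chain3 t1 t2 t3.
  - apply: neglD; first by apply: neglZ; exact: S3.
    apply: neglD; first by apply: neglZ; exact: aphi.
    by apply: neglD; apply: neglZ; exact: S3.
have com n g h : pi n g *m psi n h = psi n h *m pi n g by have [_ ->] := psiP n h.
have [M [J' [pi' [rho [props [Mm clo]]]]]] :=
  correct_commuting cH sH k0 km mk upi ipsi com S4.
exists M, (fun n => J' n *m J n), (fun n x => pi' n x.1 *m rho n x.2).
split.
- by move=> hb n; have [_ _ [_ e] _] := props n; rewrite e // bm.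
- move=> n; have [[u1 u2] cm _ _] := props n; split=> [x|x y].
    by apply: isomM; [exact: u1.1 | exact: u2.1].
  rewrite /= u1.2 u2.2 -!mulmxA; congr (_ *m _); rewrite !mulmxA; congr (_ *m _).
  exact: cm.
- by move=> n; have [_ _ [i _] _] := props n; exact: isomM.
- rewrite (_ : (fun n => _) = (fun n => ((M n)%:R - (m n)%:R) + ((m n)%:R - (k n)%:R) : R)).
    exact: neglD.
  by apply/funext => n; rewrite addrA subrK.
move=> [g h].
(* The path runs from [phi] on the product to the compression of [Phi *m Psi], then [pi *m Psi],
   [pi *m psi] and [pi *m Z]; each [fro2_tri] doubles the constants that follow. *)
apply: (@negl_le _ k k0 (fun n =>
  2 * fro2 (phi n (inlg g * inrg h)%g - phi n (inlg g) *m phi n (inrg h)) +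
  (4 * fro2 (pi n g - Phi n g) + (8 * fro2 (psi n h - Psi n h) +
   8 * fro2 (psi n h - (J' n)^h *m rho n h *m J' n))))).
- by move=> n; exact: fro2_ge0.
- move=> n; have [[u1 u2] cm [i1 _] inter] := props n.
  pose Z := (J' n)^h *m rho n h *m J' n.
  (* The adjoint of the intertwining relation at g^-1. It moves [(J' n)^h] past [pi'], so that
     compressing [pi' *m rho] yields exactly [pi *m Z]. *)
  have JpiE : (J' n)^h *m pi' n g = pi n g *m (J' n)^h.
    rewrite -[LHS]adjK adjM adjK -urepV // inter adjM urepV //.
    by rewrite adjK.
  have -> : (J' n *m J n)^h *m (pi' n g *m rho n h) *m (J' n *m J n) =
      (J n)^h *m (pi n g *m Z) *m J n.
    by rewrite /Z adjM !mulmxA -(mulmxA (J n)^h (J' n)^h) JpiE !mulmxA.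
  have -> : phi n (g, h) = phi n (inlg g * inrg h)%g by rewrite inlr.
  have t1 := fro2_tri (phi n (inlg g) *m phi n (inrg h)) (phi n (inlg g * inrg h)%g)
    ((J n)^h *m (pi n g *m Z) *m J n).
  have t2 : fro2 (phi n (inlg g) *m phi n (inrg h) - (J n)^h *m (pi n g *m Z) *m J n) <=
      fro2 (Phi n g *m Psi n h - pi n g *m Z).
    rewrite PhiPsiK -mulmxBl -mulmxBr; exact: fro2_compress.
  have t3 := fro2_tri (pi n g *m Psi n h) (Phi n g *m Psi n h) (pi n g *m Z).
  have t4 := fro2_tri (psi n h) (Psi n h) Z.
  have e1 : fro2 (Phi n g *m Psi n h - pi n g *m Psi n h) = fro2 (pi n g - Phi n g).
    by rewrite -mulmxBl fro2_unitr // fro2BC.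
  have e2 : fro2 (pi n g *m Psi n h - pi n g *m Z) = fro2 (Psi n h - Z).
    by rewrite -mulmxBr fro2_isoml //; exact: (upi n).1.
  rewrite (fro2BC (Psi n h) (psi n h)) in t4; rewrite e1 e2 in t3.
  exact: le_chain3 t1 (le_trans t2 t3) t4.
apply: neglD; first by apply: neglZ; exact: aphi.
apply: neglD; first by apply: neglZ; exact: S1.
by apply: neglD; apply: neglZ; [exact: S3 | exact: clo].
Qed.

End Product.

(** * From the common form of stability to the two original notions *)

Section Transfer.
Variable R : realType.
Local Notation C := R[i].

Lemma gen_stable_swap b (G H : groupType) :
  gen_stable R b (prod_group H G) -> gen_stable R b (prod_group G H).
Proof.
move=> st k phi k0 iphi aphi.
have [m [J [pi [bm upi iJ mk close]]]] := st k (fun n x => phi n (x.2, x.1)) k0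
  (fun n x => iphi n _) (fun x y => aphi (x.2, x.1) (y.2, y.1)).
exists m, J, (fun n x => pi n (x.2, x.1)); split => //.
- move=> n; split=> [x|x y]; first exact: (upi n).1.
  exact: ((upi n).2 (x.2, x.1) (y.2, y.1)).
- by move=> [g h]; exact: (close (h, g)).
Qed.

(** When dimensions agree [J] is a change of basis, so [J^h *m pi *m J] is again a representation
    and not merely a compression. *)
Lemma HS_stableP (Gm : groupType) : HS_stable R Gm <-> gen_stable R true Gm.
Proof.
split=> st k phi k0 iphi aphi.
  have [|pi [ipi [mul close]]] := st k phi k0 iphi.
    by move=> g h; apply/(negl_hsnorm (fun n => _ - _)).
  exists k, (fun n => 1%:M), pi; split => //.
  - by move=> n; split => [g|g h]; [exact: ipi | exact: mul].
  - by move=> n; exact: isom1.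
  - rewrite (_ : (fun n => _) = (fun _ => 0)); first exact: negl0.
    by apply/funext => n; rewrite subrr.
  - move=> g; have /(negl_hsnorm (fun n => _ - _)) := close g.
    by under [X in _ -> negl k X]eq_fun do rewrite adj1 mul1mx mulmx1.
have [|m [J [pi [bm upi iJ mk close]]]] := st k phi k0 iphi.
  by move=> g h; apply/(negl_hsnorm (fun n => _ - _)).
have mE : m = k by apply/funext => n; exact: bm.
subst m; exists (fun n g => (J n)^h *m pi n g *m J n); split; [|split].
- by move=> n g; apply: isomM (iJ n); apply: isomM ((upi n).1 g); exact: isom_adj.
- move=> n g h; rewrite (upi n).2 -!mulmxA; congr (_ *m (_ *m _)).
  by rewrite !mulmxA (unitaryC (iJ n)) mul1mx.
- by move=> g; apply/(negl_hsnorm (fun n => _ - _)).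
Qed.

Lemma corner_ulsubmx k r (le : (k <= k + r)%N) (x : 'M[C]_(k + r)) :
  corner le x = ulsubmx x.
Proof.
apply/matrixP => i j; rewrite !mxE.
by congr (x _ _); apply: val_inj.
Qed.

Definition inclusion k m (le : (k <= m)%N) : 'M[C]_(m, k) :=
  \matrix_(i, j) (i == widen_ord le j)%:R.

Lemma isom_inclusion k m (le : (k <= m)%N) : isom (inclusion le).
Proof.
apply/matrixP => i j; rewrite !mxE (bigD1 (widen_ord le j)) //= big1 ?addr0.
  rewrite adjE !mxE eqxx mulr1 conjc_nat eq_sym.
  by congr (_%:R); congr nat_of_bool; apply/eqP/eqP => [[/val_inj]|->].
by move=> l /negPf lj; rewrite [X in _ * X]mxE lj mulr0.
Qed.

Lemma corner_inclusion k m (le : (k <= m)%N) (x : 'M[C]_m) :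
  corner le x = (inclusion le)^h *m x *m inclusion le.
Proof.
apply/matrixP => i j; rewrite [LHS]mxE [RHS]mxE (bigD1 (widen_ord le j)) //= big1 ?addr0.
  rewrite [X in _ = _ * X]mxE eqxx mulr1 mxE (bigD1 (widen_ord le i)) //= big1 ?addr0.
    by rewrite adjE mxE eqxx conjc1 mul1r.
  by move=> l /negPf li; rewrite adjE mxE li conjc0 mul0r.
by move=> l /negPf lj; rewrite [X in _ * X]mxE lj mulr0.
Qed.

(** Completing [J] to a unitary [W] and conjugating [pi] by it turns the compression by [J] into the
    upper-left corner. The dimension is rewritten as k + r to make this a block of a block
    matrix. *)
Lemma HS_flex_stableP (Gm : groupType) : HS_flex_stable R Gm <-> gen_stable R false Gm.
Proof.
split=> st k phi k0 iphi aphi.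
  have [|m [le [pi [ipi [mul [mk close]]]]]] := st k phi k0 iphi.
    by move=> g h; apply/(negl_hsnorm (fun n => _ - _)).
  exists m, (fun n => inclusion (le n)), pi; split => //.
  - by move=> n; split => [g|g h]; [exact: ipi | exact: mul].
  - by move=> n; exact: isom_inclusion.
  - exact/(negl_ratio _ k0 le).
  - move=> g; have /(negl_hsnorm (fun n => _ - _)) h := close g.
    rewrite (_ : (fun n => _) = (fun n => fro2 (phi n g - corner (le n) (pi n g)))) //.
    by apply/funext => n; rewrite corner_inclusion.
have [|m [J [pi [_ upi iJ mk close]]]] := st k phi k0 iphi.
  by move=> g h; apply/(negl_hsnorm (fun n => _ - _)).
have [r [J' hJ]] : exists (r : nat -> nat) (J' : forall n, 'M[C]_(m n, r n)), forall n,
    [/\ isom (J' n), (J n)^h *m J' n = 0 & (k n + r n)%N = m n].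
  have comp n : exists p : {r : nat & 'M[C]_(m n, r)},
      [/\ isom (tagged p), (J n)^h *m tagged p = 0 & (k n + tag p)%N = m n].
    by have [r [J' [h1 h2 _ h3]]] := isom_complete (iJ n); exists (existT _ r J').
  exists (fun n => tag (projT1 (cid (comp n)))), (fun n => tagged (projT1 (cid (comp n)))).
  by move=> n; exact: (projT2 (cid (comp n))).
pose W n := row_mx (J n) (J' n).
have iW n : isom (W n) by have [h1 h2 _] := hJ n; exact: isom_row_mx.
have kr n : (k n + r n)%N = m n by have [] := hJ n.
exists (fun n => (k n + r n)%N), (fun n => leq_addr (r n) (k n)),
  (fun n g => (W n)^h *m pi n g *m W n).
have WW n : W n *m (W n)^h = 1%:M by exact: (isom_square (esym (kr n)) (iW n)).
have iWh n : isom (W n)^h by rewrite /isom adjK.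
split; [|split; [|split]].
- by move=> n g; apply: isomM (iW n); apply: isomM ((upi n).1 g); exact: iWh.
- move=> n g h; rewrite (upi n).2 -!mulmxA; congr (_ *m (_ *m _)).
  by rewrite !mulmxA WW mul1mx.
- rewrite (_ : (fun n => _) = (fun n => (m n)%:R / (k n)%:R)).
    by apply/(negl_ratio _ k0 _) => // n; exact: isom_leq (iJ n).
  by apply/funext => n; rewrite kr.
- move=> g; apply/(negl_hsnorm (fun n => _ - _)).
  rewrite (_ : (fun n => _) = (fun n => fro2 (phi n g - (J n)^h *m pi n g *m J n))) //.
  apply/funext => n; rewrite corner_ulsubmx /W adj_row_mx mul_col_mx mul_col_row.
  by rewrite block_mxKul.
Qed.

End Transfer.

Theorem theorem0p1 (R : realType) (G H : groupType) :
  countable_group G -> countable_group H ->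
  (propertyT R G \/ propertyT R H) ->
  (HS_stable R G -> HS_stable R H -> HS_stable R (prod_group G H)) /\
  (HS_flex_stable R G -> HS_flex_stable R H -> HS_flex_stable R (prod_group G H)).
Proof.
move=> cG cH T.
have main b : gen_stable R b G -> gen_stable R b H -> gen_stable R b (prod_group G H).
  move=> sG sH; case: T => T; first exact: gen_stable_prod.
  by apply: gen_stable_swap; exact: gen_stable_prod.
split; first by rewrite !HS_stableP; exact: main.
by rewrite !HS_flex_stableP; exact: main.
Qed.
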